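(* Let $A:\Xi\to\mathcal M$ be a random maximal monotone operator with mean operator $\mathcal A$, as introduced in the context. Assume the following. 1. The interior of $\mathcal D$ is not empty, and there exist a closed ball (of positive radius) contained in $\mathcal D$ and a $\mu$-integrable function $M$ such that $\|A_0(\xi,x)\|\le M(\xi)$ for any $x$ in this ball. 2. For any compact set $K\subset\mathbb R^N$, there exists $\varepsilon>0$ such that $$\sup_{x\in K\cap\mathcal D}\int\|A_0(\xi,x)\|^{1+\varepsilon}\,\mu(d\xi)<\infty ,$$ and moreover there exists $y_0\in\mathcal D$ such that $\int\|A_0(\xi,y_0)\|^{1+1/\varepsilon}\,\mu(d\xi)<\infty$. 3. There exists $C>0$ such that for any $x\in\mathbb R^N$, $\int d(\xi,x)\,\mu(d\xi)\ge C\,\boldsymbol d(x)$. 4. For every $x\in\mathbb R^N$ and $\gamma>0$, $\int\|J_\gamma(\xi,x)-\Pi(\xi,x)\|\,\mu(d\xi)\le\gamma\,C(x)$, where $C(x)$ is bounded on compact sets of $\mathbb R^N$. Then the monotone operator $\mathcal A$ is maximal.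
   Context: A set-valued operator $\mathsf A:\mathbb R^N\rightrightarrows\mathbb R^N$ is monotone if $\langle y-y',x-x'\rangle\ge0$ for all $(x,y),(x',y')$ in its graph $\mathrm{gr}(\mathsf A)$; a non-empty monotone operator is maximal if its graph is maximal for inclusion among graphs of monotone operators. $\mathcal M$ is the set of maximal monotone operators on $\mathbb R^N$; $\mathrm{dom}(\mathsf A)=\{x:\mathsf A(x)\ne\emptyset\}$; $\mathrm{cl}$ is closure. $(\Xi,\mathcal T,\mu)$ is a probability space with $\mathcal T$ $\mu$-complete. A closed-set-valued function $F$ on $\Xi$ is measurable if $\{\xi:F(\xi)\cap H\ne\emptyset\}\in\mathcal T$ for every Borel set $H$. $\mathcal S^1_F$ is the set of $\varphi\in\mathcal L^1(\Xi,\mathcal T,\mu;\mathbb R^N)$ with $\varphi(\xi)\in F(\xi)$ $\mu$-a.e.; $F$ is integrable if $\mathcal S^1_F\ne\emptyset$; its Aumann integral is $\int F\,d\mu=\{\int\varphi\,d\mu:\varphi\in\mathcal S^1_F\}$. $A:\Xi\to\mathcal M$ is such that $\xi\mapsto\mathrm{gr}(A(\xi,\cdot))$ is measurable; $A(\xi,x)$ is the image of $x$ under $A(\xi,\cdot)$. $D(\xi)=\mathrm{dom}(A(\xi,\cdot))$; for $x\in D(\xi)$, $A_0(\xi,x)$ is the element of least norm of $A(\xi,x)$; $J_\gamma(\xi,x)=(I+\gamma A(\xi,\cdot))^{-1}(x)$ for $\gamma>0$. $\Pi(\xi,\cdot)$ is the projection onto $\mathrm{cl}(D(\xi))$, and $d(\xi,\cdot)$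 the distance function to $D(\xi)$. $\mathcal D=\{x\in\mathbb R^N:\mu(\{\xi:x\in D(\xi)\})=1\}$ is assumed non-empty, $\boldsymbol d(\cdot)$ is the distance function to $\mathcal D$, and $A(\cdot,x)$ is assumed integrable for each $x\in\mathcal D$. For fixed $x\in\mathcal D$, $A_0(\xi,x)$ is defined for $\mu$-almost every $\xi$, and inequalities involving it are understood for $\mu$-almost every $\xi$. The monotone operator $\mathcal A$ has domain $\mathcal D$ and $\mathcal A(x)=\int A(\xi,x)\,\mu(d\xi)$ (Aumann integral) for $x\in\mathcal D$. *)

(* Defs.v *)
From HB Require Import structures.
From mathcomp Require Import all_boot all_order all_algebra.
From mathcomp Require Import all_classical all_reals all_analysis.

Set Implicit Arguments.
Unset Strict Implicit.
Unset Printing Implicit Defensive.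

Import Order.TTheory GRing.Theory Num.Theory.
Import numFieldNormedType.Exports.

Local Open Scope classical_set_scope.
Local Open Scope ring_scope.

(* The norm `|_| of the library on 'rV[R]_N is the sup norm, hence the explicit
   Euclidean structure below. The topology of the library on 'rV[R]_N is the
   product topology, which is the Euclidean one, and is used as is. *)
Section euclidean.
Variables (R : realType) (N : nat).
Implicit Types (x y : 'rV[R]_N) (S : set 'rV[R]_N).

Definition einner x y : R := \sum_(i < N) x 0 i * y 0 i.

Definition enorm x : R := Num.sqrt (einner x x).

Definition closed_eball x (r : R) : set 'rV[R]_N :=
  [set y | enorm (y - x) <= r].

Definition dist_set S x : R := inf [set enorm (x - y) | y in S].

(* Meaningful when S is nonempty, closed and convex; when no nearest point
   exists the value is the default 0. *)
Definition nearest_point S x : 'rV[R]_N :=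
  xget 0 [set p | S p /\ forall q, S q -> enorm (x - p) <= enorm (x - q)].

End euclidean.

(* A set-valued operator on R^N is a map sending x to the set A x. *)
Section operators.
Variables (R : realType) (N : nat).
Implicit Types (A B : 'rV[R]_N -> set 'rV[R]_N) (x : 'rV[R]_N).

Definition op_graph A : set ('rV[R]_N * 'rV[R]_N) := [set p | A p.1 p.2].

Definition op_dom A : set 'rV[R]_N := [set x | A x !=set0].

Definition op_monotone A : Prop :=
  forall p q, op_graph A p -> op_graph A q -> 0 <= einner (p.2 - q.2) (p.1 - q.1).

Definition maximal_monotone A : Prop :=
  [/\ op_graph A !=set0, op_monotone A &
      forall B, op_monotone B -> op_graph A `<=` op_graph B -> op_graph B = op_graph A].

(* Least-norm element of A x; default value 0 when x is not in op_dom A. *)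
Definition least_norm A x : 'rV[R]_N :=
  xget 0 [set v | A x v /\ forall w, A x w -> enorm v <= enorm w].

(* (I + gamma A)^-1 x, single-valued and everywhere defined when A is maximal
   monotone and gamma > 0. *)
Definition op_resolvent A (gamma : R) x : 'rV[R]_N :=
  xget 0 [set y | exists2 v, A y v & x = y + gamma *: v].

End operators.

Section set_valued.
Context {d : measure_display} {Xi : measurableType d}.

Definition set_measurable (Y : topologicalType) (F : Xi -> set Y) : Prop :=
  forall H : set Y, <<s [set U : set Y | open U] >> H ->
    measurable [set xi | F xi `&` H !=set0].

Variables (R : realType) (N : nat) (mu : {measure set Xi -> \bar R}).

Definition integrable_vec (phi : Xi -> 'rV[R]_N) : Prop :=
  forall i : 'I_N, mu.-integrable setT (fun xi => (phi xi 0 i)%:E).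

Definition integral_vec (phi : Xi -> 'rV[R]_N) : 'rV[R]_N :=
  \row_(i < N) \int[mu]_xi phi xi 0 i.

Definition integrable_selections (F : Xi -> set 'rV[R]_N) :
    set (Xi -> 'rV[R]_N) :=
  [set phi | integrable_vec phi /\ {ae mu, forall xi, F xi (phi xi)}].

Definition set_integrable (F : Xi -> set 'rV[R]_N) : Prop :=
  integrable_selections F !=set0.

Definition aumann_integral (F : Xi -> set 'rV[R]_N) : set 'rV[R]_N :=
  integral_vec @` integrable_selections F.

Variable A : Xi -> 'rV[R]_N -> set 'rV[R]_N.

Definition mean_domain : set 'rV[R]_N :=
  [set x | mu [set xi | op_dom (A xi) x] = 1%E].

Definition mean_operator (x : 'rV[R]_N) : set 'rV[R]_N :=
  [set y | mean_domain x /\ aumann_integral (fun xi => A xi x) y].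

End set_valued.

(* Main.v *)
Require Import Defs.
From HB Require Import structures.
From mathcomp Require Import all_boot all_order all_algebra.
From mathcomp Require Import all_classical all_reals all_analysis measurable_realfun.
From mathcomp Require Import ring lra.
Import Order.TTheory GRing.Theory Num.Theory.
Import numFieldNormedType.Exports.
Local Open Scope classical_set_scope.
Local Open Scope ring_scope.

Set Implicit Arguments.
Unset Strict Implicit.
Unset Printing Implicit Defensive.

(* By Minty's criterion it suffices to solve y = p + v with v in the mean
   operator at p. Replacing each A(xi) by its Yosida approximation A_g(xi) makes
   the mean operator monotone and Lipschitz, so y = x_g + \int A_g(xi, x_g) has a
   solution. Testing monotonicity at c +- r e_i, for c the centre and r the radius
   of the ball in the mean domain, bounds x_g and the L^1 norm of
   a_g = A_g(., x_g); since x_g - J_g(xi, x_g) = g a_g(xi), linear regularity puts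
   x_g within O(g) of some z in the mean domain, and as A_g is 1/g-Lipschitz,
   |a_g| <= |A_0(., z)| + O(1), so that a_g is uniformly integrable. Along x_g -> p,
   with g -> 0 fast, convex combinations of the tails of a_g converge in L^1 and
   almost surely to some phi; they inherit the monotonicity inequalities in the
   limit, whence phi(xi) is in A(xi, p), and \int phi = lim (y - x_g) = y - p. *)

(** * Euclidean structure *)

(** L^1 bounds on [a_g] alone would let mass concentrate on small sets, and the integral of the
    limit could miss part of [y - p]; the moments of order 1 + eps exclude this. They control A_0
    only on the mean domain, to which x_g need not belong: hence the comparison point z, whose
    distance O(g) is what a 1/g-Lipschitz map turns into O(1). Weak compactness in L^1 is replaced
    by a minimisation: near-minimisers of the integral of sqrt(1 + |u|^2) over convex combinations
    of tails are Cauchy in L^1 by strict convexity. Averaging respects the inclusion because, for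
    fixed (u, v) in the graph, <a - v, p - u> >= - e is an affine condition on a. The base point
    there must be p, whereas a_g(xi) belongs to A(xi) at J_g(xi, x_g); the exchange costs chiefly
    |a_g| |J_g - p| <= |a_g| (|x_g - p| + g |a_g|). This has to vanish almost surely, whence |x_g -
    p| <= q and g <= q^2 with q = 2^-(n+1), which makes q |a_g| summable in L^1. *)

Lemma cvg_fin_sum (R : realType) (V : normedModType R) (T I : Type)
    (F : set_system T) {FF : Filter F} (r : seq I) (f : I -> T -> V)
    (l : I -> V) :
  (forall i, f i @ F --> l i) ->
  (fun t => \sum_(i <- r) f i t) @ F --> \sum_(i <- r) l i.
Proof.
move=> fl; elim: r => [|i r IH].
  by under eq_fun do rewrite big_nil; rewrite big_nil; exact: cvg_cst.
by under eq_fun do rewrite big_cons; rewrite big_cons; apply: cvgD IH.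
Qed.

Section euclidean_space.
Context {R : realType} {N : nat}.
Implicit Types (x y z : 'rV[R]_N) (t : R).

Lemma einnerC x y : einner x y = einner y x.
Proof. by apply: eq_bigr => i _; rewrite mulrC. Qed.

Lemma einnerDl x y z : einner (x + y) z = einner x z + einner y z.
Proof. by rewrite -big_split; apply: eq_bigr => i _; rewrite mxE mulrDl. Qed.

Lemma einnerZl t x y : einner (t *: x) y = t * einner x y.
Proof. by rewrite mulr_sumr; apply: eq_bigr => i _; rewrite mxE mulrA. Qed.

Lemma einnerDr x y z : einner z (x + y) = einner z x + einner z y.
Proof. by rewrite einnerC einnerDl !(einnerC z). Qed.

Lemma einnerZr t x y : einner y (t *: x) = t * einner y x.
Proof. by rewrite einnerC einnerZl einnerC. Qed.

Lemma einnerNl x y : einner (- x) y = - einner x y.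
Proof. by rewrite -scaleN1r einnerZl mulN1r. Qed.

Lemma einnerNr x y : einner y (- x) = - einner y x.
Proof. by rewrite einnerC einnerNl einnerC. Qed.

Lemma einner_suml (I : Type) (r : seq I) (P : pred I) (f : I -> 'rV[R]_N) y :
  einner (\sum_(i <- r | P i) f i) y = \sum_(i <- r | P i) einner (f i) y.
Proof.
apply: (big_morph (fun x => einner x y)) => [a b|]; first exact: einnerDl.
by rewrite -(scale0r 0) einnerZl mul0r.
Qed.

Definition einnerE := (einnerDl, einnerDr, einnerNl, einnerNr, einnerZl, einnerZr).

Lemma einner_ge0 x : 0 <= einner x x.
Proof. by apply: sumr_ge0 => i _; rewrite -expr2 sqr_ge0. Qed.

Lemma enorm_ge0 x : 0 <= enorm x. Proof. exact: sqrtr_ge0. Qed.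

Lemma enorm_sqr x : enorm x ^+ 2 = einner x x.
Proof. by rewrite sqr_sqrtr// einner_ge0. Qed.

Lemma enormN x : enorm (- x) = enorm x.
Proof. by rewrite /enorm einnerNl einnerNr opprK. Qed.

Lemma enormB x y : enorm (x - y) = enorm (y - x).
Proof. by rewrite -enormN opprB. Qed.

Lemma enormZ t x : enorm (t *: x) = `|t| * enorm x.
Proof.
by rewrite /enorm einnerZl einnerZr mulrA -expr2 sqrtrM ?sqr_ge0// sqrtr_sqr.
Qed.

Lemma enorm_le x t : 0 <= t -> einner x x <= t ^+ 2 -> enorm x <= t.
Proof.
by move=> t0 xt; rewrite -(@ler_pXn2r _ 2) ?nnegrE ?enorm_ge0// enorm_sqr.
Qed.

Lemma ler_enorm_coord x i : `|x 0 i| <= enorm x.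
Proof.
rewrite -sqrtr_sqr ler_sqrt ?einner_ge0// /einner (bigD1 i)//= -expr2 lerDl.
by apply: sumr_ge0 => j _; rewrite -expr2 sqr_ge0.
Qed.

Lemma enorm_eq0 x : enorm x = 0 -> x = 0.
Proof.
move=> x0; apply/rowP => i; rewrite mxE; apply/eqP; rewrite -normr_le0 -x0.
exact: ler_enorm_coord.
Qed.

Lemma enorm0 : enorm (0 : 'rV[R]_N) = 0.
Proof. by rewrite -(scale0r 0) enormZ normr0 mul0r. Qed.

Lemma einner_le x y : einner x y <= enorm x * enorm y.
Proof.
have [x0|x0] := eqVneq (enorm x) 0.
  by rewrite (enorm_eq0 x0) enorm0 mul0r -(scale0r 0) einnerZl mul0r.
have [y0|y0] := eqVneq (enorm y) 0.
  by rewrite (enorm_eq0 y0) enorm0 mulr0 -(scale0r 0) einnerZr mul0r.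
have {}x0 : 0 < enorm x by rewrite lt_neqAle eq_sym x0 enorm_ge0.
have {}y0 : 0 < enorm y by rewrite lt_neqAle eq_sym y0 enorm_ge0.
(* This square expands to 2 |x| |y| (|x| |y| - <x, y>). *)
have := einner_ge0 (enorm y *: x - enorm x *: y).
rewrite !einnerE -!enorm_sqr (einnerC y x) => H.
rewrite -(ler_pM2l (mulr_gt0 x0 y0)); nra.
Qed.

Lemma einner_geN x y : - (enorm x * enorm y) <= einner x y.
Proof. by rewrite lerNl -einnerNl -(enormN x) einner_le. Qed.

Lemma ler_enormD x y : enorm (x + y) <= enorm x + enorm y.
Proof.
apply: enorm_le; first by rewrite addr_ge0 ?enorm_ge0.
by rewrite !einnerE -!enorm_sqr (einnerC y x); have := einner_le x y; nra.
Qed.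

Lemma ler_enorm_sum (I : Type) (r : seq I) (f : I -> 'rV[R]_N) :
  enorm (\sum_(i <- r) f i) <= \sum_(i <- r) enorm (f i).
Proof.
elim/big_ind2 : _ => // [|a b c e ab ce]; first by rewrite enorm0.
exact: le_trans (ler_enormD _ _) (lerD _ _).
Qed.

Lemma einner_delta x i : einner x (delta_mx 0 i) = x 0 i.
Proof.
rewrite /einner (bigD1 i)//= mxE !eqxx mulr1 big1 ?addr0// => j ji.
by rewrite mxE (negbTE ji) andbF mulr0.
Qed.

Lemma enorm_delta i : enorm (delta_mx 0 i : 'rV[R]_N) = 1.
Proof. by rewrite /enorm einner_delta mxE !eqxx sqrtr1. Qed.

Lemma ler_enorm_sum_coord x : enorm x <= \sum_(i < N) `|x 0 i|.
Proof.
rewrite [X in enorm X](row_sum_delta x); apply: le_trans (ler_enorm_sum _ _) _.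
by apply: ler_sum => i _; rewrite enormZ enorm_delta mulr1.
Qed.

(** Carries Euclidean bounds over to the sup norm, in which boundedness is understood in
    [closed_eball_compact]. *)
Lemma ler_mx_enorm x : `|x| <= enorm x.
Proof.
rewrite [leLHS]/Num.norm /= mx_normrE; apply/bigmax_leP; split=> [|[i j] _ /=].
  exact: enorm_ge0.
by rewrite (ord1 i) ler_enorm_coord.
Qed.

Lemma cvg_einner (T : Type) (F : set_system T) {FF : Filter F} (f g : T -> 'rV[R]_N) x y :
  f @ F --> x -> g @ F --> y ->
  (fun s => einner (f s) (g s)) @ F --> einner x y.
Proof.
move=> fx gy; apply: cvg_fin_sum => i; apply: cvgM.
  by apply: (@cvg_comp _ _ _ f (fun M => M 0 i) _ _ _ fx); exact: coord_continuous.
by apply: (@cvg_comp _ _ _ g (fun M => M 0 i) _ _ _ gy); exact: coord_continuous.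
Qed.

Lemma enorm_continuous : continuous (@enorm R N).
Proof.
move=> x; have xx : (fun y => einner y y) @ x --> einner x x.
  exact: (@cvg_einner _ (nbhs x) _ id id x x (fun _ h => h) (fun _ h => h)).
exact: (cvg_comp _ _ xx (@sqrt_continuous R _)).
Qed.

Lemma subr_continuous z : continuous (fun x : 'rV[R]_N => x - z).
Proof.
move=> x.
exact: (@cvgB _ _ _ (nbhs x) _ id (cst z) x z (fun _ h => h) (cvg_cst _)).
Qed.

Lemma closed_eball_compact x t : compact (closed_eball x t).
Proof.
apply: bounded_closed_compact.
  exists (enorm x + t); split=> [|M xM y /= yt]; first exact: num_real.
  apply: le_trans (ler_mx_enorm _) _; apply: le_trans (ltW xM).
  by rewrite -[X in enorm X](subrK x) addrC (le_trans (ler_enormD _ _))// lerD2l.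
have cf : continuous (fun y => enorm (y - x)).
  by move=> y; apply: continuous_comp; [exact: subr_continuous|exact: enorm_continuous].
exact: (preimage_closed (fun y _ => cf y) (@closed_le _ t)).
Qed.

End euclidean_space.

(** * Minty's theorem *)

Lemma ge0_of_small_perturbation (R : realFieldType) (a b : R) :
  (forall t, 0 < t <= 1 -> 0 <= a + t * b) -> 0 <= a.
Proof.
move=> H; rewrite leNgt; apply/negP => a0.
have b0 : 0 < b by have := H 1; rewrite lexx ltr01 mul1r => /(_ isT); lra.
(* At t = - a / (2 b - a) the perturbed value is a (b - a) / (2 b - a), negative when a < 0 < b. *)
have h : - a / (2 * b - a) * (2 * b - a) = - a by rewrite divfK// gt_eqF//; lra.
have p : 0 < - a / (2 * b - a) by rewrite divr_gt0//; lra.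
have q : - a / (2 * b - a) <= 1 by rewrite ler_pdivrMr; lra.
have := H (- a / (2 * b - a)); rewrite p q => /(_ isT).
by set t := - a / _ in h p q *; nra.
Qed.

Section minty.
Context {R : realType} {N : nat}.

(* The maximiser of the concave dual function of the minimax problem
   [min_x max_i <x - u i, x + v i>] over the simplex yields the saddle point. *)
Lemma monotone_extension_finite n (u v : 'I_n.+1 -> 'rV[R]_N) :
  (forall i j, 0 <= einner (v i - v j) (u i - u j)) ->
  exists x, forall i, 0 <= einner (- x - v i) (x - u i).
Proof.
move=> mono.
pose lin (F : 'I_n.+1 -> 'rV[R]_N) (l : 'rV[R]_n.+1) := \sum_i l 0 i *: F i.
pose s (l : 'rV[R]_n.+1) := \sum_i l 0 i * einner (u i) (v i).
pose w l := lin u l - lin v l.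
(* [- h l] is the dual function: the minimum over x of the sum of the l_i <x - u i, x + v i>,
   attained at [w l / 2]. *)
pose h l := einner (w l) (w l) / 4 + s l.
pose S := [set l : 'rV[R]_n.+1 | (forall i, l 0 i \in `[0, 1]) /\ \sum_i l 0 i = 1].
have coord i : continuous (fun l : 'rV[R]_n.+1 => l 0 i) by exact: coord_continuous.
have clin F : continuous (lin F).
  by move=> l; apply: (cvg_fin_sum (F := nbhs l)) => i; apply: cvgZr_tmp; exact: coord.
have cs : continuous s.
  by move=> l; apply: (cvg_fin_sum (F := nbhs l)) => i; apply: cvgMr_tmp; exact: coord.
have csum : continuous (fun l : 'rV[R]_n.+1 => \sum_i l 0 i).
  by move=> l; apply: (cvg_fin_sum (F := nbhs l)) => i; exact: coord.
have cw : continuous w by move=> l; exact: (cvgB (clin u l) (clin v l)).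
have ch : continuous h.
  move=> l; rewrite /continuous_at; apply: cvgD (cs l).
  by apply: cvgMr_tmp; exact: (cvg_einner (F := nbhs l) (cw l) (cw l)).
have compS : compact S.
  rewrite (_ : S = [set l : 'rV[R]_n.+1 | forall i, l ord0 i \in `[0, 1]] `&`
                   ((fun l : 'rV[R]_n.+1 => \sum_i l 0 i) @^-1` [set x | x = 1])); last first.
    by apply/seteqP; split.
  apply: compact_closedI; last first.
    exact: (preimage_closed (fun l _ => csum l) (@closed_eq R 1)).
  by apply: (@rV_compact R _ (fun=> `[0, 1]%classic)) => i; exact: segment_compact.
have S0 : S !=set0.
  exists (delta_mx 0 ord0); split=> [i|].
    by rewrite mxE /= in_itv/=; case: eqP; rewrite ?lexx ?ler01.
  rewrite (bigD1 ord0)//= mxE !eqxx big1 ?addr0// => i /negbTE i0.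
  by rewrite mxE i0 andbF.
have [l /set_mem[lS lsum] lmin] : exists2 c, c \in S & forall t, t \in S -> h c <= h t.
  by apply: EVT_min_rV => //; exact: continuous_subspaceT.
(* Monotonicity averaged with the weights l_i l_j gives <lin u, lin v> <= s, so that h is at least
   |lin u + lin v|^2 / 4. *)
have h0 : 0 <= h l.
  have ss : einner (lin u l) (lin v l) <= s l.
    have H j : 0 <= s l - einner (v j) (lin u l) - einner (lin v l) (u j)
                    + einner (u j) (v j).
      have -> : einner (u j) (v j) = \sum_i l 0 i * einner (u j) (v j).
        by rewrite -mulr_suml lsum mul1r.
      rewrite (einnerC (v j)) !einner_suml -!sumrB -big_split /=.
      apply: sumr_ge0 => i _; rewrite !einnerZl -!mulrBr -mulrDr.
      apply: mulr_ge0; first by have := lS i; rewrite in_itv => /andP[].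
      by have := mono i j; rewrite !einnerE (einnerC (v i)) (einnerC (v j) (u j))
        (einnerC (v j) (u i)); lra.
    have : 0 <= \sum_j l 0 j * (s l - einner (v j) (lin u l) - einner (lin v l) (u j)
                    + einner (u j) (v j)).
      apply: sumr_ge0 => j _; apply: mulr_ge0 => //.
      by have := lS j; rewrite in_itv => /andP[].
    under eq_bigr do rewrite mulrDr !mulrBr.
    rewrite big_split /= !sumrB -mulr_suml lsum mul1r -/(s l).
    rewrite (_ : \sum_i _ = einner (lin v l) (lin u l)); last first.
      by rewrite einner_suml; apply: eq_bigr => i _; rewrite einnerZl.
    rewrite (_ : \sum_i _ = einner (lin v l) (lin u l)); last first.
      rewrite (einnerC (lin v l)) einner_suml.
      by apply: eq_bigr => i _; rewrite einnerZl (einnerC (u i)).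
    by rewrite (einnerC (lin v l)); lra.
  have := einner_ge0 (lin u l + lin v l).
  by rewrite /h /w !einnerE (einnerC (lin v l)); lra.
exists (2^-1 *: w l) => i.
(* This is the derivative of [h] at its minimiser [l] towards the i-th vertex of the simplex; adding
   [h l >= 0] yields the goal. As [h] is quadratic, its increment is exactly t times the derivative
   plus t^2 times the quotient by 4 supplied next. *)
suff : 0 <= einner (w l) ((u i - v i) - w l) / 2 + (einner (u i) (v i) - s l).
  move: h0; rewrite /h; move: (w l) (s l) => w1 s1.
  by rewrite !einnerE (einnerC (v i) (u i)) (einnerC (v i) w1); lra.
apply: (@ge0_of_small_perturbation _ _
  (einner ((u i - v i) - w l) ((u i - v i) - w l) / 4)) => t /andP[t0 t1].
set e := delta_mx 0 i : 'rV[R]_n.+1.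
have eS j : 0 <= e 0 j <= 1 by rewrite mxE /=; case: eqP; rewrite ?lexx ?ler01.
have esum : \sum_j e 0 j = 1.
  rewrite (bigD1 i)//= mxE !eqxx big1 ?addr0// => j /negbTE ji.
  by rewrite mxE ji andbF.
have line (F : 'I_n.+1 -> 'rV[R]_N) : lin F (l + t *: (e - l)) = lin F l + t *: (F i - lin F l).
  rewrite /lin; under eq_bigr do rewrite !mxE scalerDl -scalerA scalerBl.
  rewrite big_split /= -scaler_sumr; congr (_ + t *: _).
  rewrite sumrB; congr (_ - _).
  rewrite (bigD1 i)//= eqxx scale1r big1 ?addr0// => j /negbTE ji.
  by rewrite ji scale0r.
have lines : s (l + t *: (e - l)) = s l + t * (einner (u i) (v i) - s l).
  rewrite /s; under eq_bigr do rewrite !mxE mulrDl -mulrA mulrBl.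
  rewrite big_split /= -mulr_sumr; congr (_ + t * _).
  rewrite sumrB; congr (_ - _).
  rewrite (bigD1 i)//= eqxx mul1r big1 ?addr0// => j /negbTE ji.
  by rewrite ji mul0r.
have : h l <= h (l + t *: (e - l)).
  apply: lmin; rewrite inE; split=> [j|].
    have -> : (l + t *: (e - l)) 0 j = l 0 j + t * (e 0 j - l 0 j) by rewrite !mxE.
    have := lS j; have := eS j; rewrite !in_itv/=; move: (e 0 j) (l 0 j) => a b.
    by move=> /andP[? ?] /andP[? ?]; apply/andP; split; nra.
  rewrite (_ : \sum_j _ = \sum_j l 0 j + t * (\sum_j e 0 j - \sum_j l 0 j)).
    by rewrite esum lsum subrr mulr0 addr0.
  rewrite -sumrB mulr_sumr -big_split.
  by apply: eq_bigr => j _; rewrite !mxE.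
rewrite {2}/h /h lines /w !line.
rewrite (_ : _ - (_ + _) = w l + t *: ((u i - v i) - w l)); last first.
  by rewrite /w; apply/rowP => j; rewrite !mxE; ring.
rewrite -/(w l); move: (w l) (u i - v i - w l) (einner (u i) (v i) - s l) => a b c.
rewrite !einnerE (einnerC b a) => H.
rewrite -(pmulr_rge0 _ t0); move: H.
lra.
Qed.

End minty.

Section minty_theorem.
Context {R : realType} {N : nat}.

(** Thales: the angle at [x] between [u] and [- v] is at least a right one exactly on the ball with
    diameter from [u] to [- v]. Compactness of these balls reduces [monotone_extension] to finitely
    many pairs. *)
Lemma half_space_eball (x u v : 'rV[R]_N) :
  0 <= einner (- x - v) (x - u) <->
  closed_eball (2^-1 *: (u - v)) (enorm (u + v) / 2) x.
Proof.
rewrite /closed_eball /=.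
have E : enorm (x - 2^-1 *: (u - v)) ^+ 2 - (enorm (u + v) / 2) ^+ 2 =
         - einner (- x - v) (x - u).
  rewrite exprMn !enorm_sqr !einnerE (einnerC u x) (einnerC v x) (einnerC v u).
  by field.
have h1 := enorm_ge0 (x - 2^-1 *: (u - v)); have h2 := enorm_ge0 (u + v).
by split=> H; [rewrite -(@ler_pXn2r _ 2) ?nnegrE ?divr_ge0//; lra|nra].
Qed.

Lemma monotone_extension (G : set ('rV[R]_N * 'rV[R]_N)) (z : 'rV[R]_N) :
  (forall p q, G p -> G q -> 0 <= einner (p.2 - q.2) (p.1 - q.1)) ->
  exists x, forall p, G p -> 0 <= einner (z - x - p.2) (x - p.1).
Proof.
move=> mono.
have [[p0 Gp0]|G0] := pselect (G !=set0); last first.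
  by exists 0 => p Gp; exfalso; apply: G0; exists p.
pose C p := closed_eball (2^-1 *: (p.1 - (p.2 - z))) (enorm (p.1 + (p.2 - z)) / 2).
have CE x p : C p x <-> 0 <= einner (z - x - p.2) (x - p.1).
  rewrite /C -half_space_eball (_ : - x - (p.2 - z) = z - x - p.2)//.
  by rewrite opprB addrA (addrC (- x)).
have := @closed_eball_compact R N (2^-1 *: (p0.1 - (p0.2 - z)))
  (enorm (p0.1 + (p0.2 - z)) / 2).
(* Intersecting with [C p0] puts all the balls inside one compact set; this is why [p0] heads the
   list [s]. *)
rewrite -/(C p0) compact_In0 => /(_ _ G (fun p => C p0 `&` C p))[].
- exists C => // p _; apply: compact_closed; first exact: norm_hausdorff.
  exact: closed_eball_compact.
- move=> D DG; pose s := p0 :: finmap.enum_fset D.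
  have sG p : p \in s -> G p.
    by rewrite inE => /predU1P[->//|/DG]; rewrite inE.
  have [|x xs] := @monotone_extension_finite R N (size (finmap.enum_fset D))
      (fun i => (nth p0 s i).1) (fun i => (nth p0 s i).2 - z).
    move=> i j; rewrite opprB addrA subrK.
    by apply: mono; apply: sG; apply: mem_nth.
  have xC p : p \in s -> C p x.
    move=> ps; have := xs (Ordinal (n:=(size (finmap.enum_fset D)).+1) (m:=index p s) _).
    rewrite -index_mem in ps => /(_ ps) /=; rewrite -/s nth_index -?index_mem//.
    by move/half_space_eball.
  exists x => p /= pD; split; apply: xC; rewrite inE ?eqxx//.
  by apply/orP; right.
- by move=> x xC; exists x => p Gp; apply/CE; have [] := xC p Gp.
Qed.

(** Adjoining [(x, v)] to the graph keeps it monotone. This is the form in which maximality is used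
    everywhere below. *)
Lemma maximal_monotone_in (A : 'rV[R]_N -> set 'rV[R]_N) (x v : 'rV[R]_N) :
  maximal_monotone A ->
  (forall p, op_graph A p -> 0 <= einner (v - p.2) (x - p.1)) -> A x v.
Proof.
move=> [_ mono max] xv.
pose B y := [set w | A y w \/ (y = x /\ w = v)].
suff BA : op_graph B = op_graph A.
  by suff : op_graph A (x, v) by []; rewrite -BA; right.
apply: max => [[y w] [y' w']|p Ap]; last by left.
rewrite /op_graph /B /=.
move=> [Ayw|[-> ->]] [Ayw'|[-> ->]].
- exact: (mono (y, w) (y', w')).
- by rewrite -(opprB v w) -(opprB x y) einnerNl einnerNr opprK; exact: (xv (y, w) Ayw).
- exact: (xv (y', w') Ayw').
- by rewrite !subrr; exact: einner_ge0.
Qed.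

(** The hard half of Minty's theorem: [monotone_extension] for the graph of g A gives a [y] such
    that (x - y) / g is monotonically related at [y] to the whole graph of [A]. *)
Lemma maximal_monotone_surjective (A : 'rV[R]_N -> set 'rV[R]_N) (g : R) x :
  maximal_monotone A -> 0 < g -> exists y v, A y v /\ x = y + g *: v.
Proof.
move=> mA g0; have [_ mono _] := mA.
pose G := [set p : 'rV[R]_N * 'rV[R]_N | A p.1 (g^-1 *: p.2)].
have [|y yG] := @monotone_extension G x.
  move=> p q Gp Gq; have := mono (p.1, g^-1 *: p.2) (q.1, g^-1 *: q.2) Gp Gq.
  by rewrite /= -scalerBr einnerZl pmulr_rge0// invr_gt0.
exists y, (g^-1 *: (x - y)); split; last first.
  by rewrite scalerA divff ?gt_eqF// scale1r addrC subrK.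
apply: maximal_monotone_in => // p Ap.
have := yG (p.1, g *: p.2); rewrite /G /= scalerA mulVf ?gt_eqF// scale1r => /(_ Ap).
rewrite (_ : g^-1 *: (x - y) - p.2 = g^-1 *: (x - y - g *: p.2)); last first.
  by rewrite [RHS]scalerBr scalerA mulVf ?gt_eqF// scale1r.
by rewrite einnerZl pmulr_rge0// invr_gt0.
Qed.

End minty_theorem.

(** * Yosida approximation and least-norm elements *)

Section yosida.
Context {R : realType} {N : nat}.
Implicit Types (A : 'rV[R]_N -> set 'rV[R]_N) (g : R) (x y v : 'rV[R]_N).

Definition yosida A g x := g^-1 *: (x - op_resolvent A g x).

Lemma monotone_resolvent_unique A g x y y' v v' : op_monotone A -> 0 < g ->
  A y v -> A y' v' -> x = y + g *: v -> x = y' + g *: v' -> y = y'.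
Proof.
move=> mono g0 Ayv Ayv' xy xy'.
have E : y - y' = g *: (v' - v).
  have -> : y = x - g *: v by rewrite xy addrK.
  have -> : y' = x - g *: v' by rewrite xy' addrK.
  by apply/rowP => i; rewrite !mxE; ring.
have := mono (y, v) (y', v') Ayv Ayv'; rewrite /= -(opprB v' v) einnerNl.
have -> : v' - v = g^-1 *: (y - y') by rewrite E scalerA mulVf ?gt_eqF// scale1r.
rewrite einnerZl -enorm_sqr oppr_ge0 pmulr_rle0 ?invr_gt0// => H.
apply/eqP; rewrite -subr_eq0; apply/eqP/enorm_eq0/eqP.
by rewrite -sqrf_eq0 eq_le H sqr_ge0.
Qed.

Variable A : 'rV[R]_N -> set 'rV[R]_N.
Hypothesis mA : maximal_monotone A.

Lemma op_resolvent_in g x : 0 < g -> A (op_resolvent A g x) (yosida A g x).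
Proof.
move=> g0; have [y [v [Ayv xE]]] := @maximal_monotone_surjective _ _ A g x mA g0.
have : exists y, exists2 v, A y v & x = y + g *: v by exists y, v.
move/(xgetPex 0); rewrite -/(op_resolvent A g x) => -[v' Av' xE'].
rewrite /yosida {2}xE' addrAC subrr add0r scalerA mulVf ?gt_eqF//.
by rewrite scale1r.
Qed.

Lemma op_resolventE g x : 0 < g -> op_resolvent A g x = x - g *: yosida A g x.
Proof.
by move=> g0; rewrite scalerA divff ?gt_eqF// scale1r opprB addrC subrK.
Qed.

Lemma op_resolvent_unique g x y v : 0 < g -> A y v -> x = y + g *: v ->
  op_resolvent A g x = y.
Proof.
move=> g0 Ayv xE; have [_ mono _] := mA.
apply: (monotone_resolvent_unique mono g0 (op_resolvent_in x g0) Ayv _ xE).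
by rewrite op_resolventE// subrK.
Qed.

(** Monotonicity of [A] between the two resolvent points, which differ from [x] and [y] by g times
    the Yosida values. Both monotonicity and the 1/g-Lipschitz bound come from it. *)
Lemma yosida_cocoercive g x y : 0 < g ->
  g * enorm (yosida A g x - yosida A g y) ^+ 2 <=
  einner (yosida A g x - yosida A g y) (x - y).
Proof.
move=> g0; have [_ mono _] := mA.
have := mono (_, _) (_, _) (op_resolvent_in x g0) (op_resolvent_in y g0).
rewrite /= !op_resolventE//; move: (yosida A g x) (yosida A g y) => a b.
rewrite (_ : x - g *: a - (y - g *: b) = (x - y) - g *: (a - b)).
  by rewrite einnerDr einnerNr einnerZr enorm_sqr subr_ge0.
by apply/rowP => i; rewrite !mxE; ring.
Qed.

Lemma yosida_monotone g x y : 0 < g ->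
  0 <= einner (yosida A g x - yosida A g y) (x - y).
Proof.
move=> g0; apply: le_trans (yosida_cocoercive x y g0).
by rewrite mulr_ge0 ?sqr_ge0// ltW.
Qed.

Lemma yosida_lipschitz g x y : 0 < g ->
  enorm (yosida A g x - yosida A g y) <= g^-1 * enorm (x - y).
Proof.
move=> g0; have := yosida_cocoercive x y g0.
have := einner_le (yosida A g x - yosida A g y) (x - y).
have := enorm_ge0 (yosida A g x - yosida A g y); have := enorm_ge0 (x - y).
move: (enorm (yosida A g x - yosida A g y)) (enorm (x - y)) => a b b0 a0 h1 h2.
rewrite mulrC ler_pdivlMr// mulrC; have [->|a1] := eqVneq a 0; first by rewrite mulr0.
have {}a0 : 0 < a by rewrite lt_neqAle eq_sym a1.
by rewrite -(ler_pM2l a0) mulrCA -expr2; lra.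
Qed.

(** Monotonicity between the resolvent point and [(x, v)] reads <v - a, a> >= 0 for the Yosida value
    a, since x minus the resolvent is g a. *)
Lemma enorm_yosida_le g x v : 0 < g -> A x v -> enorm (yosida A g x) <= enorm v.
Proof.
move=> g0 Axv; have [_ mono _] := mA.
have := mono (_, _) (_, _) (op_resolvent_in x g0) Axv.
rewrite /= op_resolventE// addrAC subrr add0r einnerNr einnerZr oppr_ge0.
rewrite pmulr_rle0// einnerDl einnerNl -enorm_sqr.
have := einner_le v (yosida A g x); have := enorm_ge0 (yosida A g x).
have := enorm_ge0 v; move: (enorm (yosida A g x)) (enorm v) => a b b0 a0 h1 h2.
have [->//|a1] := eqVneq a 0.
have {}a0 : 0 < a by rewrite lt_neqAle eq_sym a1.
by rewrite -(ler_pM2r a0) -expr2; lra.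
Qed.

Lemma maximal_monotone_closed x : closed (A x).
Proof.
have -> : A x = \bigcap_(p in op_graph A)
    (fun v => einner (v - p.2) (x - p.1)) @^-1` [set t | 0 <= t].
  apply/seteqP; split => [v Axv p Ap|v H]; last exact: maximal_monotone_in.
  by have [_ mono _] := mA; exact: (mono (x, v) p Axv Ap).
apply: closed_bigI => p _.
suff cf : continuous (fun v => einner (v - p.2) (x - p.1)).
  exact: (preimage_closed (fun y _ => cf y) (@closed_ge _ 0)).
move=> v; apply: (cvg_einner (F := nbhs v) (@subr_continuous _ _ p.2 v)).
exact: cst_continuous.
Qed.

(** The default of [xget] is not reached: it is enough to minimise over the elements of [A x] no
    longer than a given one, a compact set. *)
Lemma least_normP x : op_dom A x ->
  A x (least_norm A x) /\ forall w, A x w -> enorm (least_norm A x) <= enorm w.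
Proof.
move=> [v Axv].
suff : exists u, [set v | A x v /\ forall w, A x w -> enorm v <= enorm w] u.
  by move/(xgetPex 0).
have [| | |u] := @EVT_min_rV R N (@enorm R N) (closed_eball 0 (enorm v) `&` A x).
- by exists v; split=> //; rewrite /closed_eball /= subr0.
- apply: compact_closedI; first exact: closed_eball_compact.
  exact: maximal_monotone_closed.
- by apply: continuous_subspaceT; exact: enorm_continuous.
rewrite inE => -[uv Axu] umin; exists u; split=> // w Axw.
have [wv|vw] := leP (enorm w) (enorm v).
  by apply: umin; rewrite inE; split=> //; rewrite /closed_eball /= subr0.
by apply: le_trans (ltW vw); move: uv; rewrite /closed_eball /= subr0.
Qed.

Lemma enorm_yosida_least_norm g x : 0 < g -> op_dom A x ->
  enorm (yosida A g x) <= enorm (least_norm A x).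
Proof. by move=> g0 /least_normP[Ax _]; exact: enorm_yosida_le. Qed.

End yosida.

(** * Integrals of vector-valued functions *)

(* The integral of a nonnegative function is a supremum over the simple functions
   below it. This is applied to [dist_set] and [least_norm], whose measurability in
   the random parameter is not established. *)
Lemma ge0_le_integral_nonmeasurable d (T : measurableType d) (R : realType)
    (mu : {measure set T -> \bar R}) (f g : T -> \bar R) :
  (forall x, 0 <= f x)%E -> (forall x, f x <= g x)%E ->
  (\int[mu]_x f x <= \int[mu]_x g x)%E.
Proof.
move=> f0 fg; rewrite !ge0_integralTE//; last first.
  by move=> x; exact: le_trans (fg x).
apply: ereal_sup_le => _ [h hf <-]; exists h => // x.
exact: le_trans (fg x).
Qed.

Section integrable_real_functions.
Context d {T : measurableType d} {R : realType} {N : nat} (mu : probability T R).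
Implicit Types (f g : T -> R) (u v : T -> 'rV[R]_N).

Notation L1 f := (mu.-integrable setT (EFin \o f)).

Lemma integrable_measurable_fun f : L1 f -> measurable_fun setT f.
Proof. by move=> /measurable_int/measurable_EFinP. Qed.

Lemma integrable_cst_fun (k : R) : L1 (fun=> k).
Proof. exact: finite_measure_integrable_cst. Qed.

Lemma integrable_funD f g : L1 f -> L1 g -> L1 (fun x => f x + g x).
Proof. by move=> fi gi; apply: (integrableD _ fi gi). Qed.

Lemma integrable_funB f g : L1 f -> L1 g -> L1 (fun x => f x - g x).
Proof. by move=> fi gi; apply: (integrableB _ fi gi). Qed.

Lemma integrable_funZ (k : R) f : L1 f -> L1 (fun x => k * f x).
Proof. by move=> fi; apply: (integrableZl _ k fi). Qed.

Lemma integrable_fun_sum (I : Type) (r : seq I) (F : I -> T -> R) :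
  (forall i, L1 (F i)) -> L1 (fun x => \sum_(i <- r) F i x).
Proof.
move=> FL; elim: r => [|i r IH].
  by under eq_fun do rewrite big_nil; exact: integrable_cst_fun.
by under eq_fun do rewrite big_cons; exact: integrable_funD.
Qed.

Lemma Rintegral_sum (I : Type) (r : seq I) (F : I -> T -> R) :
  (forall i, L1 (F i)) ->
  \int[mu]_x (\sum_(i <- r) F i x) = \sum_(i <- r) \int[mu]_x F i x.
Proof.
move=> FL; elim: r => [|i r IH].
  rewrite big_nil; under eq_Rintegral do rewrite big_nil.
  by rewrite Rintegral_cst// mul0r.
rewrite big_cons -IH; under eq_Rintegral do rewrite big_cons.
by rewrite RintegralD//; exact: integrable_fun_sum.
Qed.

Lemma Rintegral_probability_cst (k : R) : \int[mu]_x k = k.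
Proof. by rewrite Rintegral_cst// [X in fine X]probability_setT mulr1. Qed.

Lemma le_integrable_fun f g : measurable_fun setT f ->
  (forall x, `|f x| <= g x) -> L1 g -> L1 f.
Proof.
move=> mf fg; apply: le_integrable => //; first exact/measurable_EFinP.
by move=> x _ /=; rewrite lee_fin (le_trans (fg x))// ler_norm.
Qed.

Lemma ae_le_integrable_fun f g : measurable_fun setT f ->
  {ae mu, forall x, `|f x| <= g x} -> L1 g -> L1 f.
Proof.
move=> mf fg gi; have mg := integrable_measurable_fun gi.
apply/integrableP; split; first exact/measurable_EFinP.
have /integrableP[_] := gi; apply: le_lt_trans.
apply: ae_ge0_le_integral => //.
- by apply: measurableT_comp => //; exact/measurable_EFinP.
- by apply: measurableT_comp => //; exact/measurable_EFinP.
- apply: filterS fg => x fx _ /=; rewrite lee_fin; exact: le_trans (ler_norm _).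
Qed.

Lemma EFin_Rintegral f : L1 f -> (\int[mu]_x f x)%:E = (\int[mu]_x (f x)%:E)%E.
Proof. by move=> fi; rewrite fineK//; exact: integrable_fin_num. Qed.

Lemma ae_le_Rintegral f g : L1 f -> L1 g -> {ae mu, forall x, f x <= g x} ->
  \int[mu]_x f x <= \int[mu]_x g x.
Proof.
move=> fi gi fg; rewrite -subr_ge0 -RintegralB//.
(* The truncation is nonnegative everywhere and changes the difference only on a null set. *)
rewrite /Rintegral (ae_eq_integral (fun x => (Num.max 0 (g x - f x))%:E))//.
- by rewrite fine_ge0// integral_ge0// => x _; rewrite lee_fin le_max lexx.
- by apply/measurable_EFinP/measurable_funB; exact: integrable_measurable_fun.
- apply/measurable_EFinP/measurable_maxr => //.
  by apply/measurable_funB; exact: integrable_measurable_fun.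
- apply: filterS fg => x fg _; congr EFin.
  by apply/esym/max_idPr; rewrite subr_ge0.
Qed.

Lemma measurable_enorm u : (forall i, measurable_fun setT (fun x => u x 0 i)) ->
  measurable_fun setT (fun x => enorm (u x)).
Proof.
move=> mu_; apply: (measurableT_comp (continuous_measurable_fun (@sqrt_continuous R))).
by apply: measurable_sum => i; apply: measurable_funM.
Qed.

Lemma integrable_vec_measurable u i : integrable_vec mu u ->
  measurable_fun setT (fun x => u x 0 i).
Proof. by move=> /(_ i) /integrable_measurable_fun. Qed.

Lemma integrable_enorm u : integrable_vec mu u -> L1 (fun x => enorm (u x)).
Proof.
move=> iu; apply: (@le_integrable_fun _ (fun x => \sum_i `|u x 0 i|)).
- by apply: measurable_enorm => i; exact: integrable_vec_measurable.
- by move=> x; rewrite ger0_norm ?enorm_ge0// ler_enorm_sum_coord.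
- by apply: integrable_fun_sum => i; exact: integrable_norm (iu i).
Qed.

Lemma le_integrable_vec u g : (forall i, measurable_fun setT (fun x => u x 0 i)) ->
  (forall x, enorm (u x) <= g x) -> L1 g -> integrable_vec mu u.
Proof.
move=> mu_ ug gi i; apply: (le_integrable_fun _ _ gi) => // x.
exact: le_trans (ler_enorm_coord _ _) (ug x).
Qed.

Lemma integrable_einner u w : integrable_vec mu u -> L1 (fun x => einner (u x) w).
Proof.
move=> iu; apply: integrable_fun_sum => i.
by apply: (integrableZr _ (w 0 i) (iu i)).
Qed.

Lemma Rintegral_einner u w : integrable_vec mu u ->
  \int[mu]_x einner (u x) w = einner (integral_vec mu u) w.
Proof.
move=> iu; rewrite /einner Rintegral_sum => [|i].
  by apply: eq_bigr => i _; rewrite mxE RintegralZr//; exact: iu.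
by apply: (integrableZr _ (w 0 i) (iu i)).
Qed.

Lemma integrable_vecD u v : integrable_vec mu u -> integrable_vec mu v ->
  integrable_vec mu (fun x => u x + v x).
Proof.
move=> iu iv i; under eq_fun do rewrite mxE.
exact: integrable_funD (iu i) (iv i).
Qed.

Lemma integrable_vecZ k u : integrable_vec mu u -> integrable_vec mu (fun x => k *: u x).
Proof.
by move=> iu i; under eq_fun do rewrite mxE; exact: integrable_funZ (iu i).
Qed.

Lemma integrable_vecB u v : integrable_vec mu u -> integrable_vec mu v ->
  integrable_vec mu (fun x => u x - v x).
Proof.
move=> iu iv i; under eq_fun do rewrite !mxE.
exact: integrable_funB (iu i) (iv i).
Qed.

Lemma integral_vecD u v : integrable_vec mu u -> integrable_vec mu v ->
  integral_vec mu (fun x => u x + v x) = integral_vec mu u + integral_vec mu v.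
Proof.
move=> iu iv; apply/rowP => i; rewrite !mxE.
under eq_Rintegral do rewrite mxE.
by rewrite RintegralD//; [exact: iu|exact: iv].
Qed.

Lemma integral_vecZ k u : integrable_vec mu u ->
  integral_vec mu (fun x => k *: u x) = k *: integral_vec mu u.
Proof.
move=> iu; apply/rowP => i; rewrite !mxE.
under eq_Rintegral do rewrite mxE.
by rewrite RintegralZl//; exact: iu.
Qed.

Lemma integral_vecB u v : integrable_vec mu u -> integrable_vec mu v ->
  integral_vec mu (fun x => u x - v x) = integral_vec mu u - integral_vec mu v.
Proof.
move=> iu iv; apply/rowP => i; rewrite !mxE.
under eq_Rintegral do rewrite !mxE.
by rewrite RintegralB//; [exact: iu|exact: iv].
Qed.

(** The bounds add up to [k]. The sum stays in the extended reals, as it may be infinite on a null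
    set; its integrability gives almost sure convergence, and it also serves as dominating function
    in [L1_cauchy_limit]. *)
Lemma integrable_series (F : nat -> T -> R) (k : R) :
  (forall n x, 0 <= F n x) -> (forall n, L1 (F n)) ->
  (forall n, \int[mu]_x F n x <= k / (2 ^ n.+1)%:R) ->
  mu.-integrable setT (fun x => \sum_(n <oo) (F n x)%:E)%E.
Proof.
move=> F0 FL Fk.
have mF n : measurable_fun setT (EFin \o F n).
  exact/measurable_EFinP/integrable_measurable_fun.
have k0 : 0 <= k.
  have := Fk 0%N; rewrite -(@pmulr_lge0 _ (2 ^ 1)%:R^-1) ?invr_gt0//.
  by apply: le_trans; apply: Rintegral_ge0 => x _.
apply/integrableP; split.
  apply: (@ge0_emeasurable_sum _ _ _ setT (fun n => EFin \o F n) xpredT) => [n x _ _|n _].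
    by rewrite lee_fin.
  exact: mF.
have F0' x : (0 <= \sum_(n <oo) (F n x)%:E)%E.
  by apply: nneseries_ge0 => n _ _; rewrite lee_fin.
under eq_integral do rewrite gee0_abs//.
rewrite integral_nneseries//; last by move=> n x _; rewrite lee_fin.
apply: (@le_lt_trans _ _ (\sum_(n <oo) (k / (2 ^ n.+1)%:R)%:E)%E).
  apply: lee_nneseries => [n _ _|n _].
    by apply: integral_ge0 => x _; rewrite lee_fin.
  by rewrite -EFin_Rintegral// lee_fin.
exact: le_lt_trans (epsilon_trick0 _ k0) (ltry _).
Qed.

Lemma ae_is_cvg_series (F : nat -> T -> R) (k : R) :
  (forall n x, 0 <= F n x) -> (forall n, L1 (F n)) ->
  (forall n, \int[mu]_x F n x <= k / (2 ^ n.+1)%:R) ->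
  {ae mu, forall x, cvgn (series (F ^~ x))}.
Proof.
move=> F0 FL Fk; have := integrable_ae measurableT (integrable_series F0 FL Fk).
apply: filterS => x /(_ I) fx; apply: nnseries_is_cvg => //.
by rewrite ltey_eq fx.
Qed.

End integrable_real_functions.

(** * Convex combinations of tails of uniformly integrable sequences *)

(** Dyadic convex combinations of the tail from [n] on. Midpoints suffice for the strict convexity
    argument, and whatever is stable under midpoints passes to the hull by induction. *)
Inductive midpoint_hull (R : realType) (N : nat) (T : Type)
    (a : nat -> T -> 'rV[R]_N) (n : nat) : (T -> 'rV[R]_N) -> Prop :=
| midpoint_hull_gen k : (n <= k)%N -> midpoint_hull a n (a k)
| midpoint_hull_mid f g : midpoint_hull a n f -> midpoint_hull a n g ->
    midpoint_hull a n (fun x => 2^-1 *: (f x + g x)).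

Section strict_convexity.
Context {R : realType} {N : nat}.
Implicit Types u v : 'rV[R]_N.

(* A strictly convex function of linear growth: its integral is finite on L^1. *)
Definition japanese_bracket u : R := Num.sqrt (1 + einner u u).

Lemma japanese_bracket_sqr u : japanese_bracket u ^+ 2 = 1 + enorm u ^+ 2.
Proof. by rewrite sqr_sqrtr ?enorm_sqr// addr_ge0 ?einner_ge0. Qed.

Lemma japanese_bracket_ge0 u : 0 <= japanese_bracket u.
Proof. exact: sqrtr_ge0. Qed.

Lemma enorm_lt_japanese_bracket u : enorm u < japanese_bracket u.
Proof.
have := japanese_bracket_sqr u; have := japanese_bracket_ge0 u.
by have := enorm_ge0 u; nra.
Qed.

Lemma japanese_bracket_le u : japanese_bracket u <= 1 + enorm u.
Proof.
have := japanese_bracket_sqr u; have := japanese_bracket_ge0 u.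
by have := enorm_ge0 u; nra.
Qed.

Definition midpoint_gap u v := japanese_bracket u + japanese_bracket v
  - 2 * japanese_bracket (2^-1 *: (u + v)).

(** Quantitative strict convexity. The cube matches the radial second derivative of sqrt(1 + r^2),
    which is (1 + r^2)^(-3/2). *)
Lemma midpoint_gap_ge u v : 0 <= midpoint_gap u v /\
  2 * enorm (u - v) ^+ 2 <=
  midpoint_gap u v * (japanese_bracket u + japanese_bracket v) ^+ 3.
Proof.
rewrite /midpoint_gap.
have hs := japanese_bracket_sqr (2^-1 *: (u + v)).
have ha := japanese_bracket_sqr u; have hb := japanese_bracket_sqr v.
have a0 := enorm_lt_japanese_bracket u; have b0 := enorm_lt_japanese_bracket v.
have s0 := japanese_bracket_ge0 (2^-1 *: (u + v)).
have D0 := enorm_ge0 (u - v); have u0 := enorm_ge0 u; have v0 := enorm_ge0 v.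
have Duv : enorm (u - v) <= enorm u + enorm v.
  by have := ler_enormD u (- v); rewrite enormN.
have par : enorm (u + v) ^+ 2 = 2 * enorm u ^+ 2 + 2 * enorm v ^+ 2 - enorm (u - v) ^+ 2.
  by rewrite !enorm_sqr !einnerE (einnerC v u); ring.
have cs : (enorm u ^+ 2 - enorm v ^+ 2) ^+ 2 <= enorm (u - v) ^+ 2 * enorm (u + v) ^+ 2.
  rewrite -exprMn.
  have -> : enorm u ^+ 2 - enorm v ^+ 2 = einner (u - v) (u + v).
    by rewrite !enorm_sqr !einnerE (einnerC v u); ring.
  have := einner_le (u - v) (u + v); have := einner_geN (u - v) (u + v).
  by nra.
move: hs; rewrite enormZ exprMn par gtr0_norm ?invr_gt0// => hs.
move: cs; rewrite par => cs.
move: (enorm (u - v)) (enorm u) (enorm v) (japanese_bracket u) (japanese_bracket v)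
  (japanese_bracket (2^-1 *: (u + v))) D0 u0 v0 a0 b0 s0 Duv ha hb hs cs
  => D x y al be s D0 x0 y0 xa yb s0 Dxy ha hb hs cs.
have {}hs : 4 * s ^+ 2 = 2 * al ^+ 2 + 2 * be ^+ 2 - D ^+ 2.
  by rewrite hs ha hb; field.
have {}cs : (al ^+ 2 - be ^+ 2) ^+ 2 <= D ^+ 2 * (4 * s ^+ 2 - 4).
  have -> : al ^+ 2 - be ^+ 2 = x ^+ 2 - y ^+ 2 by lra.
  by apply: le_trans cs _; rewrite hs; nra.
have DP : D ^+ 2 < (al + be) ^+ 2 by nra.
(* This is the Cauchy-Schwarz bound [cs] with [s] eliminated by the parallelogram identity. By [fac]
   the first factor is the gap times al + be + 2 s, so the sign of the gap and its lower bound both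
   follow. *)
have key : 4 * D ^+ 2 <= (D ^+ 2 - (al - be) ^+ 2) * ((al + be) ^+ 2 - D ^+ 2).
  by rewrite hs in cs; lra.
have ab1 : 0 < al + be by lra.
have DQ : 0 <= D ^+ 2 - (al - be) ^+ 2.
  rewrite -(@pmulr_lge0 _ ((al + be) ^+ 2 - D ^+ 2)) ?subr_gt0//.
  by apply: le_trans key; rewrite mulr_ge0// sqr_ge0.
have fac : D ^+ 2 - (al - be) ^+ 2 = (al + be - 2 * s) * (al + be + 2 * s).
  by lra.
have sm : 2 * s <= al + be.
  by rewrite -(@ler_pXn2r _ 2) ?nnegrE ?mulr_ge0//; lra.
split; first by lra.
have k2 : 4 * D ^+ 2 <= (D ^+ 2 - (al - be) ^+ 2) * (al + be) ^+ 2.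
  by apply: le_trans key _; apply: ler_wpM2l => //; have := sqr_ge0 D; lra.
have k3 : D ^+ 2 - (al - be) ^+ 2 <= (al + be - 2 * s) * (2 * (al + be)).
  by rewrite fac; apply: ler_wpM2l; lra.
have k4 := ler_wpM2r (sqr_ge0 (al + be)) k3.
by have := le_trans k2 k4; lra.
Qed.

(* The gap controls [u - v] as long as [u] and [v] are bounded by multiples of [k];
   the truncated terms absorb the other case. *)
Lemma enorm_sub_le_gap u v (t k : R) : 0 < t -> 0 <= k ->
  enorm (u - v) <= t + (4 * k + 4) ^+ 3 / (8 * t) * midpoint_gap u v
    + 2 * (Num.max 0 (enorm u - k) + Num.max 0 (enorm v - k)).
Proof.
move=> t0 k0; have [G0 G] := midpoint_gap_ge u v.
have D0 := enorm_ge0 (u - v); have u0 := enorm_ge0 u; have v0 := enorm_ge0 v.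
have Duv : enorm (u - v) <= enorm u + enorm v.
  by have := ler_enormD u (- v); rewrite enormN.
have ul := japanese_bracket_le u; have vl := japanese_bracket_le v.
have um0 : 0 <= Num.max 0 (enorm u - k) by rewrite le_max lexx.
have vm0 : 0 <= Num.max 0 (enorm v - k) by rewrite le_max lexx.
have um : enorm u - k <= Num.max 0 (enorm u - k) by rewrite le_max lexx orbT.
have vm : enorm v - k <= Num.max 0 (enorm v - k) by rewrite le_max lexx orbT.
have s0 : 0 <= japanese_bracket u + japanese_bracket v.
  by rewrite addr_ge0 ?japanese_bracket_ge0.
have gt : 0 <= (4 * k + 4) ^+ 3 / (8 * t) * midpoint_gap u v.
  by rewrite mulr_ge0// divr_ge0 ?exprn_ge0//; lra.
(* Otherwise |u| + |v| > 4 k + 2, so |u| + |v| <= 2 ((|u| - k) + (|v| - k)) and the truncated terms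
   suffice. *)
have [sq|sq] := leP (japanese_bracket u + japanese_bracket v) (4 * k + 4); last by lra.
suff : enorm (u - v) <= t + (4 * k + 4) ^+ 3 / (8 * t) * midpoint_gap u v by lra.
have q3 : (japanese_bracket u + japanese_bracket v) ^+ 3 <= (4 * k + 4) ^+ 3.
  by rewrite lerXn2r// nnegrE; lra.
have {q3} := le_trans G (ler_wpM2l G0 q3).
move: (enorm (u - v)) ((4 * k + 4) ^+ 3) (midpoint_gap u v) => D q G1 DG.
rewrite -(ler_pM2l (_ : 0 < 8 * t)) ?mulr_gt0// mulrDr mulrA mulrCA divff ?mulr1; last first.
  by rewrite gt_eqF// mulr_gt0.
(* This is D <= t + D^2 / (4 t). *)
have := sqr_ge0 (D - 2 * t); rewrite sqrrB; nra.
Qed.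

End strict_convexity.

Section midpoint_hull_basic.
Context {T : Type} {R : realType} {N : nat}.
Variable a : nat -> T -> 'rV[R]_N.
Implicit Types (f g : T -> 'rV[R]_N) (n m k : nat).

Lemma midpoint_hull_mono n m f : (n <= m)%N -> midpoint_hull a m f -> midpoint_hull a n f.
Proof.
move=> nm; elim=> [k mk|g h _ ng _ nh]; last exact: midpoint_hull_mid.
by apply: midpoint_hull_gen; exact: leq_trans mk.
Qed.

Lemma midpoint_hull_at (P : 'rV[R]_N -> Prop) n x f :
  (forall k, (n <= k)%N -> P (a k x)) ->
  (forall u v, P u -> P v -> P (2^-1 *: (u + v))) ->
  midpoint_hull a n f -> P (f x).
Proof. by move=> Pa Pmid; elim=> [k /Pa//|g h _ ng _ nh]; exact: Pmid. Qed.

End midpoint_hull_basic.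

Section midpoint_hull_theory.
Context d {T : measurableType d} {R : realType} {N : nat} (mu : probability T R).
Variable a : nat -> T -> 'rV[R]_N.
Implicit Types (f g : T -> 'rV[R]_N) (n m k : nat).

Notation L1 f := (mu.-integrable setT (EFin \o f)).

Hypothesis ia : forall n, integrable_vec mu (a n).

Lemma midpoint_hull_integrable n f : midpoint_hull a n f -> integrable_vec mu f.
Proof.
by elim=> [k _|g h _ ng _ nh]; [exact: ia|exact/integrable_vecZ/integrable_vecD].
Qed.

Lemma integral_midpoint_hull n f (P : 'rV[R]_N -> Prop) :
  (forall k, (n <= k)%N -> P (integral_vec mu (a k))) ->
  (forall u v, P u -> P v -> P (2^-1 *: (u + v))) ->
  midpoint_hull a n f -> P (integral_vec mu f).
Proof.
move=> Pa Pmid; elim=> [k /Pa//|g h hg Pg hh Ph].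
have ig := midpoint_hull_integrable hg; have ih := midpoint_hull_integrable hh.
by rewrite integral_vecZ ?integral_vecD//; [exact: Pmid|exact: integrable_vecD].
Qed.

Lemma integrable_tail f (c : R) : integrable_vec mu f ->
  L1 (fun x => Num.max 0 (enorm (f x) - c)).
Proof.
move=> iv; have ie := integrable_enorm iv.
apply: (@le_integrable_fun _ _ _ _ _ (fun x => enorm (f x) + `|c|)).
- apply: measurable_maxr => //; apply: measurable_funB => //.
  exact: (integrable_measurable_fun ie).
- move=> x; rewrite ger0_norm ?le_max ?lexx// ge_max addr_ge0 ?enorm_ge0//=.
  by rewrite lerD2l -normrN ler_norm.
- exact: integrable_funD ie (integrable_cst_fun _ _).
Qed.

(** The function max(0, |u| - c) is convex. For this reason uniform integrability is expressed with
    it, rather than with integrals over the sets where |a| > c. *)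
Lemma midpoint_hull_tail n f (c e : R) :
  (forall k, \int[mu]_x Num.max 0 (enorm (a k x) - c) <= e) ->
  midpoint_hull a n f -> \int[mu]_x Num.max 0 (enorm (f x) - c) <= e.
Proof.
move=> ae; elim=> [k _//|g h hg eg hh eh].
have ig := integrable_tail c (midpoint_hull_integrable hg).
have ih := integrable_tail c (midpoint_hull_integrable hh).
apply: (@le_trans _ _ (\int[mu]_x (2^-1 * (Num.max 0 (enorm (g x) - c)
    + Num.max 0 (enorm (h x) - c))))).
  apply: le_Rintegral => //.
  - by apply/integrable_tail/integrable_vecZ/integrable_vecD;
      [exact: (midpoint_hull_integrable hg)|exact: (midpoint_hull_integrable hh)].
  - exact/integrable_funZ/integrable_funD.
  move=> x _; rewrite enormZ gtr0_norm ?invr_gt0//.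
  have := ler_enormD (g x) (h x).
  rewrite ge_max mulr_ge0 ?addr_ge0 ?le_max ?lexx//=.
  have : enorm (g x) - c <= Num.max 0 (enorm (g x) - c) by rewrite le_max lexx orbT.
  have : enorm (h x) - c <= Num.max 0 (enorm (h x) - c) by rewrite le_max lexx orbT.
  by lra.
by rewrite RintegralZl ?RintegralD//; [lra|exact: integrable_funD].
Qed.

Lemma integrable_japanese_bracket f : integrable_vec mu f ->
  L1 (fun x => japanese_bracket (f x)).
Proof.
move=> iv; have ie := integrable_enorm iv.
apply: (@le_integrable_fun _ _ _ _ _ (fun x => 1 + enorm (f x))).
- apply: (measurableT_comp (continuous_measurable_fun (@sqrt_continuous R))).
  apply: measurable_funD => //; apply: measurable_sum => i.
  by apply: measurable_funM; exact: (integrable_vec_measurable i iv).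
- by move=> x; rewrite ger0_norm ?japanese_bracket_ge0// japanese_bracket_le.
- exact: integrable_funD (integrable_cst_fun _ _) ie.
Qed.

Lemma integrable_midpoint_gap f g : integrable_vec mu f -> integrable_vec mu g ->
  L1 (fun x => midpoint_gap (f x) (g x)).
Proof.
move=> iv ig; apply: integrable_funB.
  by apply: integrable_funD; exact: integrable_japanese_bracket.
exact/integrable_funZ/integrable_japanese_bracket/integrable_vecZ/integrable_vecD.
Qed.

Hypothesis unif_int : forall e, 0 < e ->
  exists c, forall n, \int[mu]_x Num.max 0 (enorm (a n x) - c) <= e.

Let Phi f := \int[mu]_x japanese_bracket (f x).

Let Phi_gap f g : integrable_vec mu f -> integrable_vec mu g ->
  \int[mu]_x midpoint_gap (f x) (g x) =
  Phi f + Phi g - 2 * Phi (fun x => 2^-1 *: (f x + g x)).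
Proof.
move=> iv ig; have h1 := integrable_japanese_bracket iv.
have h2 := integrable_japanese_bracket ig.
have h3 := integrable_japanese_bracket (integrable_vecZ 2^-1 (integrable_vecD iv ig)).
rewrite RintegralB//; last 2 first.
- exact: integrable_funD.
- exact: integrable_funZ.
by rewrite RintegralD// RintegralZl.
Qed.

Let Psi n := inf [set Phi f | f in midpoint_hull a n].

Let Phi_ge0 f : 0 <= Phi f.
Proof. by apply: Rintegral_ge0 => x _; exact: japanese_bracket_ge0. Qed.

Let Psi_le n f : midpoint_hull a n f -> Psi n <= Phi f.
Proof.
move=> hf; apply: ge_inf; last by exists f.
by exists 0 => _ [g _ <-]; exact: Phi_ge0.
Qed.

Let Psi_nondecreasing n m : (n <= m)%N -> Psi n <= Psi m.
Proof.
move=> nm; apply: lb_le_inf.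
  by exists (Phi (a m)); exists (a m) => //; exact: midpoint_hull_gen.
by move=> _ [f hf <-]; apply: Psi_le; exact: midpoint_hull_mono hf.
Qed.

Let Psi_bounded : exists M, forall n, Psi n <= M.
Proof.
have [c ac] := unif_int ltr01; exists (2 + `|c|) => n.
apply: le_trans (Psi_le (midpoint_hull_gen a (leqnn n))) _.
have it := integrable_tail c (ia n).
apply: (@le_trans _ _ (\int[mu]_x ((1 + `|c|) + Num.max 0 (enorm (a n x) - c)))).
  apply: le_Rintegral => //; first exact: integrable_japanese_bracket.
    exact: integrable_funD (integrable_cst_fun _ _) it.
  move=> x _; apply: le_trans (japanese_bracket_le _) _.
  have : enorm (a n x) - c <= Num.max 0 (enorm (a n x) - c) by rewrite le_max lexx orbT.
  by have := ler_norm c; lra.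
rewrite RintegralD ?Rintegral_probability_cst//; last exact: integrable_cst_fun.
by have := ac n; lra.
Qed.

Let L := sup (range Psi).

Let Psi_le_L n : Psi n <= L.
Proof.
have [M PM] := Psi_bounded; apply: ub_le_sup; last by exists n.
by exists M => _ [k _ <-].
Qed.

Let Psi_near_L (e : R) : 0 < e -> exists n, L - e < Psi n.
Proof.
move=> e0; have [M PM] := Psi_bounded.
have [|_ [n _ <-] nL] := @sup_adherent R (range Psi) e e0; last by exists n.
by split; [exists (Psi 0%N); exists 0%N|exists M => _ [k _ <-]].
Qed.

(** The midpoint of [f] and [g] stays in the hull, so its [Phi] is at least [Psi m'], which is close
    to [L], while [Phi f] and [Phi g] hardly exceed [L]. The integrated gap is thus small, and
    [enorm_sub_le_gap] turns this into an L^1 estimate. *)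
Let near_minimisers (e : R) : 0 < e -> exists m, forall m' f g, (m <= m')%N ->
  midpoint_hull a m' f -> midpoint_hull a m' g ->
  Phi f <= L + m'.+1%:R^-1 -> Phi g <= L + m'.+1%:R^-1 ->
  \int[mu]_x enorm (f x - g x) <= e.
Proof.
move=> e0; have [c0 ac0] := unif_int (divr_gt0 e0 (ltr0n R 16)).
pose c := `|c0|.
have ac n : \int[mu]_x Num.max 0 (enorm (a n x) - c) <= e / 16.
  apply: le_trans (ac0 n); apply: le_Rintegral => //; do ?exact: integrable_tail.
  move=> x _; rewrite ge_max !le_max lexx /=; apply/orP; right.
  by rewrite lerD2l lerN2 ler_norm.
(* The coefficient of the gap in [enorm_sub_le_gap] for t = e / 4. That t, the gap and the two tails
   contribute e / 4 each. *)
pose K := (4 * c + 4) ^+ 3 / (8 * (e / 4)).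
have K0 : 0 < K.
  apply: divr_gt0; last by rewrite mulr_gt0 ?divr_gt0.
  by apply: exprn_gt0; rewrite ltr_wpDl// mulr_ge0// /c.
have r0 : 0 < e / 16 / K by do 2 apply: divr_gt0 => //.
have [n Ln] := Psi_near_L r0.
have [m mr] : exists m, m.+1%:R^-1 < e / 16 / K.
  exists (Num.truncn (e / 16 / K)^-1).
  by rewrite invf_plt ?posrE ?ltr0n// truncnS_gt.
exists (maxn n m) => m' f g; rewrite geq_max => /andP[nm' mm'] hf hg Lf Lg.
have iv := midpoint_hull_integrable hf; have ig := midpoint_hull_integrable hg.
have mr' : m'.+1%:R^-1 <= (m.+1%:R^-1 : R).
  by rewrite lef_pV2 ?posrE ?ltr0n// ler_nat.
have Lm := Psi_nondecreasing nm'.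
have Pm := Psi_le (midpoint_hull_mid hf hg).
have tf := midpoint_hull_tail ac hf; have tg := midpoint_hull_tail ac hg.
have itf := integrable_tail c iv; have itg := integrable_tail c ig.
have igap := integrable_midpoint_gap iv ig.
have iB : L1 (fun x => enorm (f x - g x)) := integrable_enorm (integrable_vecB iv ig).
apply: (@le_trans _ _ (\int[mu]_x (e / 4 + K * midpoint_gap (f x) (g x)
    + 2 * (Num.max 0 (enorm (f x) - c) + Num.max 0 (enorm (g x) - c))))).
  apply: le_Rintegral => //.
  - apply: integrable_funD; last exact/integrable_funZ/integrable_funD.
    by apply: integrable_funD; [exact: integrable_cst_fun|exact: integrable_funZ].
  - by move=> x _; apply: enorm_sub_le_gap; rewrite /c ?divr_gt0.
rewrite RintegralD//; last 2 first.
- by apply: integrable_funD; [exact: integrable_cst_fun|exact: integrable_funZ].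
- exact/integrable_funZ/integrable_funD.
rewrite RintegralD//; last 2 first.
- exact: integrable_cst_fun.
- exact: integrable_funZ.
rewrite Rintegral_probability_cst RintegralZl// RintegralZl//; last exact: integrable_funD.
rewrite Phi_gap// RintegralD//.
have : Phi f + Phi g - 2 * Phi (fun x => 2^-1 *: (f x + g x)) <= 4 * (e / 16 / K).
  by move: (Phi f) (Phi g) (Phi _) (Psi m') (Psi n) (e / 16 / K) (m'.+1%:R^-1 : R)
    (m.+1%:R^-1 : R) Ln mr Lf Lg mr' Lm Pm => *; lra.
move=> /(ler_wpM2l (ltW K0)).
have -> : K * (4 * (e / 16 / K)) = e / 4 by field; rewrite gt_eqF.
by lra.
Qed.

Lemma midpoint_hull_cauchy_L1 : exists h, (forall n, midpoint_hull a n (h n)) /\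
  forall n, \int[mu]_x enorm (h n.+1 x - h n x) <= 1 / (2 ^ n.+1)%:R.
Proof.
have /choice[m hm] : forall n, exists m, forall m' f g, (m <= m')%N ->
  midpoint_hull a m' f -> midpoint_hull a m' g ->
  Phi f <= L + m'.+1%:R^-1 -> Phi g <= L + m'.+1%:R^-1 ->
  \int[mu]_x enorm (f x - g x) <= 1 / (2 ^ n.+1)%:R.
  by move=> n; apply: near_minimisers; rewrite divr_gt0// ltr0n expn_gt0.
(* [M] dominates both [n] and [m n] and is nondecreasing, so [h n.+1] also lies in the hull from
   [M n] and meets the tolerance there. *)
pose M n := (n + \sum_(i < n.+1) m i)%N.
have mM n : (m n <= M n)%N.
  by rewrite /M big_ord_recr /= addnA leq_addl.
have MS n : (M n <= M n.+1)%N.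
  by rewrite /M [X in (_ <= _ + X)%N]big_ord_recr /= leq_add ?leqnSn ?leq_addr.
have /choice[h hh] : forall n, exists h, midpoint_hull a (M n) h /\
    Phi h <= L + (M n).+1%:R^-1.
  move=> n; have e0 : 0 < (M n).+1%:R^-1 :> R by rewrite invr_gt0 ltr0n.
  have [|_ [f hf <-] Pf] := @inf_adherent R [set Phi f | f in midpoint_hull a (M n)] _ e0.
    split; first by exists (Phi (a (M n))), (a (M n)) => //; exact: midpoint_hull_gen.
    by exists 0 => _ [g _ <-]; exact: Phi_ge0.
  exists f; split=> //; apply: ltW; apply: lt_le_trans Pf _.
  by rewrite lerD2r; exact: Psi_le_L.
exists h; split=> n; have [h1 h2] := hh n.
  by apply: midpoint_hull_mono h1; rewrite /M leq_addr.
have [h3 h4] := hh n.+1; apply: (hm n (M n)) => //; first exact: midpoint_hull_mono h3.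
by apply: le_trans h4 _; rewrite lerD2l lef_pV2 ?posrE ?ltr0n// ler_nat ltnS.
Qed.

End midpoint_hull_theory.

(** * Almost sure limits of the convex combinations *)

Section limits.
Context d {T : measurableType d} {R : realType} {N : nat} (mu : probability T R).

Lemma cvg_of_summable_increments (u : nat -> R) (F : nat -> R) :
  (forall n, `|u n.+1 - u n| <= F n) -> cvgn (series F) -> cvgn u.
Proof.
move=> uF cF; have tF : cvgn (series (telescope u)).
  apply: normed_cvg; apply: series_le_cvg cF => //= m.
  exact: le_trans (uF m).
have -> : u = (fun n => u 0%N + series (telescope u) n).
  by apply/funext => n; exact: eq_sum_telescope.
by apply: is_cvgD => //; exact: is_cvg_cst.
Qed.

Lemma L1_cauchy_limit (h : nat -> T -> 'rV[R]_N) (k : R) :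
  (forall n, integrable_vec mu (h n)) ->
  (forall n, \int[mu]_x enorm (h n.+1 x - h n x) <= k / (2 ^ n.+1)%:R) ->
  exists phi, [/\ integrable_vec mu phi,
    {ae mu, forall x i, h n x 0 i @[n --> \oo] --> phi x 0 i} &
    forall i, integral_vec mu (h n) 0 i @[n --> \oo] --> integral_vec mu phi 0 i].
Proof.
move=> ih hk.
pose F n x := enorm (h n.+1 x - h n x).
have F0 n x : 0 <= F n x by exact: enorm_ge0.
have iF n : mu.-integrable setT (EFin \o F n).
  by apply/integrable_enorm/integrable_vecB.
have iG := integrable_series F0 iF hk.
have cF := ae_is_cvg_series F0 iF hk.
have inc i n x : `|h n.+1 x 0 i - h n x 0 i| <= F n x.
  by apply: le_trans (ler_enorm_coord _ i); rewrite !mxE.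
(* The upper limit is measurable on the whole space and equals the limit wherever the increments are
   summable. *)
pose phi x : 'rV[R]_N := \row_i fine (limn_esup (fun n => (h n x 0 i)%:E)).
have mh i n : measurable_fun setT (fun x => (h n x 0 i)%:E).
  exact/measurable_EFinP/integrable_vec_measurable.
have mphi i : measurable_fun setT (fun x => (phi x 0 i)%:E).
  apply/measurable_EFinP; under eq_fun do rewrite mxE.
  by apply: measurableT_comp => //; exact: measurable_fun_limn_esup.
have hphi : {ae mu, forall x i, h n x 0 i @[n --> \oo] --> phi x 0 i}.
  apply: filterS cF => x cF i; rewrite mxE.
  have /cvg_ex[l hl] := cvg_of_summable_increments (fun n => inc i n x) cF.
  have hlE : (h n x 0 i)%:E @[n --> \oo] --> l%:E by exact: cvg_EFin (nearW _ _) hl.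
  rewrite is_cvg_limn_esupE; last by apply/cvg_ex; exists l%:E.
  by rewrite (cvg_lim _ hlE).
have dom i := @dominated_convergence _ T R mu setT measurableT
  (fun n x => (h n x 0 i)%:E) (fun x => (phi x 0 i)%:E)
  (fun x => `|h 0%N x 0 i|%:E + \sum_(n <oo) (F n x)%:E)%E (mh i) (mphi i).
have {}dom i : [/\ mu.-integrable setT (fun x => (phi x 0 i)%:E),
    (\int[mu]_x `|(h n x 0 i)%:E - (phi x 0 i)%:E|)%E @[n --> \oo] --> 0%E &
    (\int[mu]_x (h n x 0 i)%:E)%E @[n --> \oo] --> (\int[mu]_x (phi x 0 i)%:E)%E].
  apply: dom.
  - by apply: filterS hphi => x hx _; exact: cvg_EFin (nearW _ _) (hx i).
  - by apply: integrableD => //; exact: integrable_norm (ih 0%N i).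
  - apply: aeW => x n _.
    apply: (@le_trans _ _ (`|h 0%N x 0 i|%:E + \sum_(0 <= j < n) (F j x)%:E)%E); last first.
      by rewrite leeD2l//; apply: nneseries_lim_ge => j _ _; rewrite lee_fin.
    rewrite sumEFin -EFinD lee_fin.
    elim: n => [|n IH]; first by rewrite big_nil addr0.
    rewrite big_nat_recr//= addrA.
    have := inc i n x; have := ler_normD (h n.+1 x 0 i - h n x 0 i) (h n x 0 i).
    by rewrite subrK; lra.
exists phi; split=> // [i|i]; first by have [] := dom i.
have [iphi _ hi] := dom i; rewrite !mxE; under eq_fun do rewrite mxE.
apply: fine_cvg; rewrite fineK//; exact: integrable_fin_num.
Qed.

End limits.

Lemma cvg_einner_coord (R : realType) (N : nat) (u : nat -> 'rV[R]_N) (l w : 'rV[R]_N) :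
  (forall i, u n 0 i @[n --> \oo] --> l 0 i) ->
  einner (u n) w @[n --> \oo] --> einner l w.
Proof.
move=> ul; apply: (cvg_fin_sum (F := \oo)) => i.
by apply: cvgMr_tmp; exact: ul.
Qed.

(** Stands in for the Dunford-Pettis theorem: averaging buys almost sure convergence, which the
    pointwise inclusion requires. *)
Lemma uniformly_integrable_hull_limit d (T : measurableType d) (R : realType) (N : nat) (mu : probability T R)
    (a : nat -> T -> 'rV[R]_N) :
  (forall n, integrable_vec mu (a n)) ->
  (forall e, 0 < e ->
    exists c, forall n, \int[mu]_x Num.max 0 (enorm (a n x) - c) <= e) ->
  exists h phi, [/\ forall n, midpoint_hull a n (h n), integrable_vec mu phi,
    {ae mu, forall x w, einner (h n x) w @[n --> \oo] --> einner (phi x) w} &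
    forall w, einner (integral_vec mu (h n)) w @[n --> \oo] -->
      einner (integral_vec mu phi) w].
Proof.
move=> ia ui; have [h [hh hk]] := midpoint_hull_cauchy_L1 ia ui.
have ih n := midpoint_hull_integrable ia (hh n).
have [phi [iphi aephi Ephi]] := L1_cauchy_limit ih hk.
exists h, phi; split=> //; last by move=> w; exact: cvg_einner_coord.
by apply: filterS aephi => x hx w; exact: cvg_einner_coord.
Qed.

(** For fixed (u, v) in the graph, moving the base point from [y n] to [x] costs at most (|a n| +
    |v|) |y n - x|, which tends to 0. What remains is a half-space condition on [a n], stable under
    midpoints and limits; maximality concludes. *)
Lemma midpoint_hull_limit_in (T : Type) (R : realType) (N : nat)
    (A : 'rV[R]_N -> set 'rV[R]_N) (a h : nat -> T -> 'rV[R]_N) (t : T)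
    (y : nat -> 'rV[R]_N) (x phi : 'rV[R]_N) :
  maximal_monotone A -> (forall n, A (y n) (a n t)) ->
  enorm (y n - x) @[n --> \oo] --> (0 : R) ->
  enorm (a n t) * enorm (y n - x) @[n --> \oo] --> (0 : R) ->
  (forall n, midpoint_hull a n (h n)) ->
  (forall w, einner (h n t) w @[n --> \oo] --> einner phi w) ->
  A x phi.
Proof.
move=> mA Aya yx ayx hh hphi; apply: maximal_monotone_in => // -[u v] Auv /=.
have [_ mono _] := mA.
rewrite einnerDl einnerNl -lerBlDr sub0r opprK.
suff low e : 0 < e -> einner v (x - u) - e <= einner phi (x - u).
  apply/ler_addgt0Pr => e e0; rewrite -lerBlDr; exact: low.
move=> e0.
have err : enorm (a n t) * enorm (y n - x) + enorm v * enorm (y n - x) @[n --> \oo]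
    --> (0 : R).
  by rewrite -[X in _ --> X](addr0 0) -[X in _ + X](mulr0 (enorm v)); apply: cvgD => //;
    apply: cvgMl_tmp.
have [n0 _ n0P] : \forall n \near \oo,
    enorm (a n t) * enorm (y n - x) + enorm v * enorm (y n - x) < e.
  exact: (cvgr_lt 0 err).
suff : \forall n \near \oo, einner v (x - u) - e <= einner (h n t) (x - u).
  move=> H; rewrite -(cvg_lim _ (hphi (x - u)))//.
  by apply: limr_ge H; apply/cvg_ex; exists (einner phi (x - u)).
exists n0 => // n n0n; have hn := midpoint_hull_mono n0n (hh n).
pose P z := einner v (x - u) - e <= einner z (x - u).
apply: (@midpoint_hull_at T R N a P n0 t (h n) _ _ hn) => [k n0k|p q]; last first.
  by rewrite /P einnerZl einnerDl; lra.
rewrite /P; have := mono (y k, a k t) (u, v) (Aya k) Auv.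
have := n0P k n0k; rewrite /=.
have -> : y k - u = (y k - x) + (x - u) by rewrite addrA subrK.
rewrite einnerDr !einnerDl !einnerNl.
have := einner_le (a k t) (y k - x); have := einner_geN v (y k - x).
by lra.
Qed.

(** * Random maximal monotone operators *)

(** [monotone_extension] on the graph of [F] gives an [x] to be tested at x - t w, where w = x + F x
    - y: this yields |w|^2 <= t K |w|^2 for small t, so w = 0. *)
Lemma monotone_lipschitz_surjective (R : realType) (N : nat)
    (F : 'rV[R]_N -> 'rV[R]_N) (K : R) (y : 'rV[R]_N) :
  0 <= K -> (forall x x', 0 <= einner (F x - F x') (x - x')) ->
  (forall x x', enorm (F x - F x') <= K * enorm (x - x')) ->
  exists x, x + F x = y.
Proof.
move=> K0 mono lip.
have [|x xP] := @monotone_extension R N [set p | p.2 = F p.1] y.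
  by move=> [u v] [u' v'] /= -> ->.
exists x; pose w := F x - (y - x).
suff : enorm w ^+ 2 <= 0.
  move=> w0; have /enorm_eq0 : enorm w = 0.
    by apply/eqP; rewrite -sqrf_eq0 eq_le w0 sqr_ge0.
  by move/eqP; rewrite subr_eq0 => /eqP ->; rewrite addrC subrK.
rewrite -oppr_ge0; apply: (@ge0_of_small_perturbation _ _ (K * enorm w ^+ 2)).
move=> t /andP[t0 t1]; have := xP (x - t *: w, F (x - t *: w)) erefl.
rewrite /= opprB addrCA subrr addr0 einnerZr pmulr_rge0//.
have -> : y - x - F (x - t *: w) = - w + (F x - F (x - t *: w)).
  by apply/rowP => i; rewrite !mxE; ring.
rewrite einnerDl einnerNl -enorm_sqr => /le_trans; apply.
rewrite lerD2l; apply: le_trans (einner_le _ _) _.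
have := lip x (x - t *: w); rewrite opprB addrCA subrr addr0 enormZ gtr0_norm// => h.
by have := ler_wpM2r (enorm_ge0 w) h; lra.
Qed.

(** The easy half of Minty's theorem: a pair (u, v) of a monotone extension is compared with the
    pair (x, w) of [A] having the same sum, and then v - w = - (u - x) forces u = x. *)
Lemma maximal_monotone_of_surjective (R : realType) (N : nat)
    (A : 'rV[R]_N -> set 'rV[R]_N) :
  op_monotone A -> (forall y, exists x v, A x v /\ x + v = y) -> maximal_monotone A.
Proof.
move=> mono surj; split=> //.
  by have [x [v [Axv _]]] := surj 0; exists (x, v).
move=> B monoB AB; apply/seteqP; split=> // -[u v] Buv.
have [x [w [Axw xw]]] := surj (u + v).
have := monoB (u, v) (x, w) Buv (AB (x, w) Axw) => /=.
have -> : v - w = - (u - x).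
  by apply/eqP; rewrite opprB subr_eq -addrA addrCA addrC -subr_eq opprK xw addrC.
rewrite einnerNl oppr_ge0 -enorm_sqr => ux.
have /enorm_eq0/eqP : enorm (u - x) = 0.
  by apply/eqP; rewrite -sqrf_eq0 eq_le ux sqr_ge0.
rewrite subr_eq0 => /eqP uE; move: xw Axw; rewrite uE => /addrI <- .
by [].
Qed.

Section random_operator.
Context d {Xi : measurableType d} {R : realType} {N : nat} (mu : probability Xi R).
Variable A : Xi -> 'rV[R]_N -> set 'rV[R]_N.
Hypothesis A_maximal : forall xi, maximal_monotone (A xi).
Hypothesis A_measurable : set_measurable (fun xi => op_graph (A xi)).
Implicit Types (x y : 'rV[R]_N) (g : R).

Lemma measurable_graph_meets_closed (H : set ('rV[R]_N * 'rV[R]_N)) : closed H ->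
  measurable [set xi | op_graph (A xi) `&` H !=set0].
Proof.
move=> cH; apply: A_measurable; rewrite -(setCK H); apply: sigma_algebraC.
by apply: sub_sigma_algebra; exact: closed_openC.
Qed.

Lemma measurable_op_dom x : measurable [set xi | op_dom (A xi) x].
Proof.
rewrite (_ : [set xi | _] = [set xi | op_graph (A xi) `&`
    (fst @^-1` [set x]) !=set0]); last first.
  apply/seteqP; split => [xi [v Av]|xi [[u v] [/= Auv ux]]].
    by exists (x, v).
  by exists v; rewrite -ux.
apply: measurable_graph_meets_closed.
apply: preimage_closed => [p _|]; first exact: cvg_fst.
by apply: accessible_closed_set1; apply: hausdorff_accessible; exact: norm_hausdorff.
Qed.

(** As the resolvent is single-valued, its i-th coordinate is at least [r] exactly when the graph
    meets a closed set, namely p1 + g p2 = x with the i-th coordinate of p1 at least [r]. *)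
Lemma measurable_op_resolvent g x i : 0 < g ->
  measurable_fun setT (fun xi => op_resolvent (A xi) g x 0 i).
Proof.
move=> g0; apply: (measurability (@RGenCInfty.G R)) => [|/= _ [_] [r] -> <-].
  exact: RGenCInfty.measurableE.
rewrite setTI (_ : _ @^-1` _ = [set xi | op_graph (A xi) `&`
   ((fun p : 'rV[R]_N * 'rV[R]_N => p.1 + g *: p.2) @^-1` [set x] `&`
    (fun p : 'rV[R]_N * 'rV[R]_N => p.1 0 i) @^-1` [set s | r <= s]) !=set0]); last first.
  apply/seteqP; split => [xi /=|xi [[u v] /= [Auv [uvx ru]]]].
    rewrite in_itv /= andbT => ri.
    exists (op_resolvent (A xi) g x, yosida (A xi) g x); split.
      exact: (op_resolvent_in (A_maximal xi) x g0).
    by split=> //=; rewrite op_resolventE// subrK.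
  by rewrite in_itv /= andbT (op_resolvent_unique (A_maximal xi) g0 Auv).
have c1 : continuous (fun p : 'rV[R]_N * 'rV[R]_N => p.1 + g *: p.2).
  by move=> p; apply: cvgD; [exact: cvg_fst|apply: cvgZl_tmp; exact: cvg_snd].
have c2 : continuous (fun p : 'rV[R]_N * 'rV[R]_N => p.1 0 i).
  move=> p; apply: (@continuous_comp _ _ _ fst (fun u : 'rV[R]_N => u 0 i)).
    exact: cvg_fst.
  exact: coord_continuous.
apply: measurable_graph_meets_closed; apply: closedI.
  apply: (preimage_closed (fun p _ => c1 p)); apply: accessible_closed_set1.
  by apply: hausdorff_accessible; exact: norm_hausdorff.
exact: (preimage_closed (fun p _ => c2 p) (@closed_ge R r)).
Qed.

Lemma measurable_yosida g x i : 0 < g ->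
  measurable_fun setT (fun xi => yosida (A xi) g x 0 i).
Proof.
move=> g0; under eq_fun do rewrite !mxE.
apply: measurable_funM => //; apply: measurable_funB => //.
exact: measurable_op_resolvent.
Qed.

Lemma mean_domain_ae x : mean_domain mu A x <-> {ae mu, forall xi, op_dom (A xi) x}.
Proof.
have mD := measurable_op_dom x.
have DC : mu (~` [set xi | op_dom (A xi) x]) = (1 - mu [set xi | op_dom (A xi) x])%E.
  exact: probability_setC.
have fD : mu [set xi | op_dom (A xi) x] \is a fin_num by exact: fin_num_measure.
split=> [Dx|[S [mS S0 DS]]].
  exists (~` [set xi | op_dom (A xi) x]); split => //; first exact: measurableC.
  by rewrite DC Dx subee.
have : mu (~` [set xi | op_dom (A xi) x]) = 0%E.
  by apply: subset_measure0 DS S0 => //; exact: measurableC.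
rewrite DC /mean_domain /= -(fineK fD) -EFinB => /eqP.
by rewrite eqe subr_eq0 => /eqP <-.
Qed.

Lemma mean_operator_monotone : op_monotone (mean_operator mu A).
Proof.
move=> [x v] [x' v'] [_ [phi [iphi Aphi] <-]] [_ [psi [ipsi Apsi] <-]] /=.
rewrite -integral_vecB// -Rintegral_einner; last exact: integrable_vecB.
rewrite -[leLHS](Rintegral_probability_cst mu 0); apply: ae_le_Rintegral.
- exact: integrable_cst_fun.
- exact/integrable_einner/integrable_vecB.
- apply: filterS2 Aphi Apsi => xi Axi Axi'.
  by have [_ mono _] := A_maximal xi; exact: (mono (x, phi xi) (x', psi xi)).
Qed.

End random_operator.

(** * The regularised mean equation and its a priori bounds *)

Section yosida_regularization.
Context d {Xi : measurableType d} {R : realType} {N : nat} (mu : probability Xi R).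
Variable A : Xi -> 'rV[R]_N -> set 'rV[R]_N.
Hypothesis A_maximal : forall xi, maximal_monotone (A xi).
Hypothesis A_measurable : set_measurable (fun xi => op_graph (A xi)).
Variables (c : 'rV[R]_N) (r : R) (M : Xi -> R).
Hypothesis r0 : 0 < r.
Hypothesis ball_domain : closed_eball c r `<=` mean_domain mu A.
Hypothesis iM : mu.-integrable setT (EFin \o M).
Hypothesis ball_bound : forall x, closed_eball c r x ->
  {ae mu, forall xi, enorm (least_norm (A xi) x) <= M xi}.

Notation L1 f := (mu.-integrable setT (EFin \o f)).
Notation D := (mean_domain mu A).

Let m := \int[mu]_xi M xi.

Let center : closed_eball c r c.
Proof. by rewrite /closed_eball /= subrr enorm0 ltW. Qed.

Let ball_yosida (g : R) x : 0 < g -> closed_eball c r x ->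
  {ae mu, forall xi, enorm (yosida (A xi) g x) <= M xi}.
Proof.
move=> g0 xB; have Dx := (mean_domain_ae mu A_measurable x).1 (ball_domain xB).
apply: filterS2 Dx (ball_bound xB) => xi Dx; apply: le_trans.
exact: enorm_yosida_least_norm.
Qed.

(** At the centre [c] the integrand is dominated by [M], and elsewhere it differs from its value at
    [c] by at most |x - c| / g. *)
Lemma integrable_yosida g x : 0 < g -> integrable_vec mu (fun xi => yosida (A xi) g x).
Proof.
move=> g0; have my y i := measurable_yosida A_maximal A_measurable y i g0.
have ic : L1 (fun xi => enorm (yosida (A xi) g c)).
  apply: (@ae_le_integrable_fun _ _ _ _ _ M) => //.
    by apply: measurable_enorm => i; exact: my.
  apply: filterS (ball_yosida g0 center) => xi; rewrite ger0_norm//.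
  exact: enorm_ge0.
apply: (@le_integrable_vec _ _ _ _ _ _
  (fun xi => enorm (yosida (A xi) g c) + g^-1 * enorm (x - c))) => [i|xi|].
- exact: my.
- rewrite -[X in enorm X](subrK (yosida (A xi) g c)) addrC.
  by apply: le_trans (ler_enormD _ _) _; rewrite lerD2l yosida_lipschitz.
- exact: integrable_funD ic (integrable_cst_fun _ _).
Qed.

Definition mean_yosida g x := integral_vec mu (fun xi => yosida (A xi) g x).

Lemma einner_mean_yosidaB g x x' w : 0 < g ->
  einner (mean_yosida g x - mean_yosida g x') w =
  \int[mu]_xi einner (yosida (A xi) g x - yosida (A xi) g x') w.
Proof.
move=> g0; have iy z := integrable_yosida z g0.
rewrite -integral_vecB// -Rintegral_einner//; exact: integrable_vecB.
Qed.

Lemma mean_yosida_monotone g x x' : 0 < g ->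
  0 <= einner (mean_yosida g x - mean_yosida g x') (x - x').
Proof.
move=> g0; rewrite einner_mean_yosidaB//; apply: Rintegral_ge0 => xi _.
exact: yosida_monotone.
Qed.

Lemma mean_yosida_lipschitz g x x' : 0 < g ->
  enorm (mean_yosida g x - mean_yosida g x') <= g^-1 * enorm (x - x').
Proof.
move=> g0; have iy z := integrable_yosida z g0.
set w := mean_yosida g x - mean_yosida g x'.
have : enorm w ^+ 2 <= g^-1 * enorm (x - x') * enorm w.
  rewrite enorm_sqr {1}/w einner_mean_yosidaB//.
  rewrite -[leRHS](Rintegral_probability_cst mu); apply: le_Rintegral => //.
  - exact/integrable_einner/integrable_vecB.
  - exact: integrable_cst_fun.
  move=> xi _; apply: le_trans (einner_le _ _) _.
  by apply: ler_wpM2r; [exact: enorm_ge0|exact: yosida_lipschitz].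
have [->|w0] := eqVneq (enorm w) 0; first by rewrite mulr_ge0 ?invr_ge0 ?enorm_ge0// ltW.
by rewrite expr2 ler_pM2r// lt_neqAle eq_sym w0 enorm_ge0.
Qed.

Lemma mean_yosida_solution g y : 0 < g -> exists x, x + mean_yosida g x = y.
Proof.
move=> g0; apply: (@monotone_lipschitz_surjective _ _ _ g^-1).
- by rewrite invr_ge0 ltW.
- by move=> x x'; exact: mean_yosida_monotone.
- by move=> x x'; exact: mean_yosida_lipschitz.
Qed.

Section solution_bounds.
Variables (y : 'rV[R]_N).

Let rho := enorm (y - c) + m.

Let m_ge0 : 0 <= m.
Proof.
rewrite -[leLHS](Rintegral_probability_cst mu); apply: ae_le_Rintegral => //.
  exact: integrable_cst_fun.
apply: filterS (ball_bound center) => xi; apply: le_trans; exact: enorm_ge0.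
Qed.

Let rho_ge0 : 0 <= rho. Proof. by rewrite addr_ge0 ?enorm_ge0. Qed.

(** The equation turns monotonicity between [x] and [c] into |x - c|^2 <= (|y - c| + m) |x - c|. *)
Lemma solution_bounded g x : 0 < g -> x + mean_yosida g x = y -> enorm (x - c) <= rho.
Proof.
move=> g0 xy; have iy z := integrable_yosida z g0.
have := mean_yosida_monotone x c g0.
have -> : mean_yosida g x = (y - c) - (x - c) by rewrite opprB addrA subrK -xy addrC addKr.
have -> : einner (y - c - (x - c) - mean_yosida g c) (x - c) = einner (y - c) (x - c)
    - enorm (x - c) ^+ 2 - einner (mean_yosida g c) (x - c).
  by move: (y - c) (x - c) => p q; rewrite enorm_sqr !einnerE.
move=> h.
have Yc : - einner (mean_yosida g c) (x - c) <= m * enorm (x - c).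
  rewrite -einnerNr -Rintegral_einner// /m -RintegralZr//; apply: ae_le_Rintegral.
  - exact: integrable_einner.
  - exact: (integrableZr _ (enorm (x - c)) iM).
  apply: filterS (ball_yosida g0 center) => xi hM.
  apply: le_trans (einner_le _ _) _; rewrite enormN.
  by apply: ler_wpM2r => //; exact: enorm_ge0.
have yc := einner_le (y - c) (x - c); have x0 := enorm_ge0 (x - c).
rewrite leNgt; apply/negP => H; have b0 := le_lt_trans rho_ge0 H.
have := ltr_pM2l b0 rho (enorm (x - c)); rewrite H /rho => /idP; lra.
Qed.

(** Monotonicity between [x] and c + s e_i, for s = r and s = - r, bounds r |a_i| pointwise by <a, x
    - c> + (rho + r) M. The integral of the right-hand side is under control since the integral of a
    is y - x. *)
Let coord_bound g x i : 0 < g -> x + mean_yosida g x = y ->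
  r * \int[mu]_xi `|yosida (A xi) g x 0 i| <=
  enorm (y - c) * rho + (rho + r) * m.
Proof.
move=> g0 xy; have iy z := integrable_yosida z g0.
have xr := solution_bounded g0 xy.
have signed (s : R) : `|s| = r -> {ae mu, forall xi,
    s * yosida (A xi) g x 0 i <= einner (yosida (A xi) g x) (x - c) + (rho + r) * M xi}.
  move=> sr; pose u := c + s *: delta_mx 0 i.
  have uB : closed_eball c r u.
    by rewrite /closed_eball /= /u addrAC subrr add0r enormZ enorm_delta sr mulr1.
  apply: filterS (ball_yosida g0 uB) => xi uM.
  have := yosida_monotone (A_maximal xi) x u g0.
  have xu : enorm (x - u) <= rho + r.
    rewrite /u opprD addrA; apply: le_trans (ler_enormD _ _) _.
    by rewrite enormN enormZ enorm_delta sr mulr1 lerD2r.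
  have := einner_geN (yosida (A xi) g u) (x - u).
  have : enorm (yosida (A xi) g u) * enorm (x - u) <= (rho + r) * M xi.
    by rewrite mulrC; apply: ler_pM; rewrite ?enorm_ge0.
  have -> : einner (yosida (A xi) g x - yosida (A xi) g u) (x - u) =
      einner (yosida (A xi) g x) (x - c) - s * yosida (A xi) g x 0 i
      - einner (yosida (A xi) g u) (x - u).
    rewrite einnerDl einnerNl; congr (_ - _).
    have -> : x - u = (x - c) - s *: delta_mx 0 i by rewrite /u opprD addrA.
    by rewrite [LHS]einnerDr einnerNr einnerZr einner_delta.
  by lra.
have iabs : L1 (fun xi => `|yosida (A xi) g x 0 i|) := integrable_norm (iy x i).
have iRHS : L1 (fun xi => einner (yosida (A xi) g x) (x - c) + (rho + r) * M xi).
  by apply: integrable_funD; [exact: integrable_einner|exact: integrable_funZ].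
apply: (@le_trans _ _ (\int[mu]_xi (einner (yosida (A xi) g x) (x - c) + (rho + r) * M xi))).
  rewrite -RintegralZl//; apply: ae_le_Rintegral => //; first exact: integrable_funZ.
  apply: filterS2 (signed r (gtr0_norm r0)) (signed (- r) _) => [xi|].
    by move: (yosida _ _ _ 0 i) => a; have [] := ger0P a; lra.
  by rewrite normrN gtr0_norm.
rewrite RintegralD//; [|exact: integrable_einner|exact: integrable_funZ].
rewrite RintegralZl// lerD2r Rintegral_einner// -/(mean_yosida g x).
have -> : mean_yosida g x = (y - c) - (x - c) by rewrite opprB addrA subrK -xy addrC addKr.
rewrite einnerDl einnerNl -enorm_sqr.
have := einner_le (y - c) (x - c); have := sqr_ge0 (enorm (x - c)).
have := ler_wpM2l (enorm_ge0 (y - c)) xr; lra.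
Qed.

Lemma solution_yosida_bounded : exists K, forall g x, 0 < g ->
  x + mean_yosida g x = y -> \int[mu]_xi enorm (yosida (A xi) g x) <= K.
Proof.
exists (N%:R * ((enorm (y - c) * rho + (rho + r) * m) / r)) => g x g0 xy.
have iy z := integrable_yosida z g0.
have iabs i : L1 (fun xi => `|yosida (A xi) g x 0 i|) := integrable_norm (iy x i).
apply: (@le_trans _ _ (\int[mu]_xi (\sum_(i < N) `|yosida (A xi) g x 0 i|))).
  apply: le_Rintegral => //; first exact: integrable_enorm.
    exact: integrable_fun_sum.
  by move=> xi _; exact: ler_enorm_sum_coord.
rewrite Rintegral_sum// mulr_natl -[X in _ *+ X](card_ord N) -sumr_const.
by apply: ler_sum => i _; rewrite ler_pdivlMr// mulrC; exact: coord_bound.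
Qed.

End solution_bounds.

(** The resolvent point lies in the domain of [A xi], at distance g |a(xi)| from [x], so the mean
    distance is at most g K. The extra 1 pays for choosing [z] within g of the infimum, which need
    not be attained. *)
Lemma near_mean_domain (C K g : R) x : 0 < C -> 0 < g ->
  ((C * dist_set D x)%:E <= \int[mu]_xi (dist_set (op_dom (A xi)) x)%:E)%E ->
  \int[mu]_xi enorm (yosida (A xi) g x) <= K ->
  exists2 z, D z & enorm (x - z) <= g * (K / C + 1).
Proof.
move=> C0 g0 CD aK; have iy := integrable_yosida x g0.
have lb S : lbound [set enorm (x - z) | z in S] 0.
  by move=> _ [z _ <-]; exact: enorm_ge0.
have dle : C * dist_set D x <= g * K.
  rewrite -lee_fin (le_trans CD)//.
  apply: (@le_trans _ _ (\int[mu]_xi (g * enorm (yosida (A xi) g x))%:E)%E).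
    apply: ge0_le_integral_nonmeasurable => xi; rewrite lee_fin.
      apply: lb_le_inf => //; have [[[u v] Auv] _ _] := A_maximal xi.
      by exists (enorm (x - u)), u => //; exists v.
    apply: ge_inf; first by exists 0; exact: lb.
    exists (op_resolvent (A xi) g x); first by exists (yosida (A xi) g x); exact: op_resolvent_in.
    by rewrite op_resolventE// opprB addrCA subrr addr0 enormZ gtr0_norm.
  rewrite -EFin_Rintegral; last exact/integrable_funZ/integrable_enorm.
  by rewrite lee_fin RintegralZl ?ler_pM2l//; exact: integrable_enorm.
have [|_ [z Dz <-] zd] := @inf_adherent R [set enorm (x - z) | z in D] g g0.
  by split; [exists (enorm (x - c)), c => //; exact: ball_domain|exists 0; exact: lb].
exists z => //; apply: ltW; apply: lt_le_trans zd _.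
rewrite mulrDr mulr1 lerD2r mulrA ler_pdivlMr// mulrC; exact: dle.
Qed.

Lemma yosida_uniformly_integrable (L eps B : R) (S : set 'rV[R]_N) : 0 <= L -> 0 < eps ->
  (forall z, S z -> D z ->
    (\int[mu]_xi (enorm (least_norm (A xi) z) `^ (1 + eps))%:E <= B%:E)%E) ->
  forall e, 0 < e -> exists k, forall g x z, 0 < g -> S z -> D z ->
    enorm (x - z) <= g * L ->
    \int[mu]_xi Num.max 0 (enorm (yosida (A xi) g x) - k) <= e.
Proof.
move=> L0 eps0 SB e e0.
(* Chosen so that b e >= B and b > 0. Let a be the least norm at [z]; the excess of the Yosida norm
   over k + L is at most a and vanishes unless a > k, where a^eps >= b. Hence b times the excess is
   at most a^(1 + eps). *)
pose b := (`|B| / e + 1); have b0 : 0 < b by rewrite ltr_wpDl// divr_ge0// ltW.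
pose k := b `^ eps^-1.
have kb : k `^ eps = b by rewrite -powRrM mulVf ?gt_eqF// powRr1// ltW.
have k0 : 0 <= k by exact: powR_ge0.
exists (k + L) => g x z g0 Sz Dz xz.
have iy := integrable_yosida x g0; have it := integrable_tail (k + L) iy.
have mD := measurable_op_dom A_measurable z.
have dom_ae := (mean_domain_ae mu A_measurable z).1 Dz.
pose f xi := Num.max 0 (enorm (yosida (A xi) g x) - (k + L)).
suff : (\int[mu]_xi (b * f xi)%:E <= B%:E)%E.
  rewrite -EFin_Rintegral; last exact: integrable_funZ.
  rewrite lee_fin RintegralZl// => bf.
  rewrite -(ler_pM2l b0); apply: le_trans bf _; rewrite mulrDl mul1r divfK ?gt_eqF//.
  by have := ler_norm B; lra.
apply: le_trans (SB z Sz Dz).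
(* Off the domain [least_norm] is the default 0 and the comparison may fail. The indicator makes it
   hold everywhere, as [ge0_le_integral_nonmeasurable] demands. *)
apply: (@le_trans _ _ (\int[mu]_xi ((b * f xi)%:E * (\1_[set xi | op_dom (A xi) z] xi)%:E))%E).
  have mbf : measurable_fun setT (fun xi => (b * f xi)%:E).
    exact: (measurable_int mu (integrable_funZ b it)).
  rewrite (ae_eq_integral (fun xi => (b * f xi)%:E *
      (\1_[set xi | op_dom (A xi) z] xi)%:E)%E)//.
    by apply: emeasurable_funM => //; apply/measurable_EFinP; exact: measurable_indic.
  by apply: filterS dom_ae => xi zD _; rewrite indicE mem_set// mule1.
have f0 xi : 0 <= f xi by rewrite le_max lexx.
apply: ge0_le_integral_nonmeasurable => xi.
  by rewrite -EFinM lee_fin indicE mulr_ge0// mulr_ge0// ltW.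
rewrite indicE; have [zD|_] := boolP (xi \in _); last by rewrite mule0 lee_fin powR_ge0.
rewrite mule1 lee_fin /f; move: zD; rewrite inE /= => zD.
set a := enorm (least_norm (A xi) z).
have ya : enorm (yosida (A xi) g x) <= a + L.
  rewrite -[X in enorm X](subrK (yosida (A xi) g z)) addrC.
  apply: le_trans (ler_enormD _ _) _; apply: lerD.
    exact: enorm_yosida_least_norm.
  apply: le_trans (yosida_lipschitz (A_maximal xi) _ _ g0) _.
  by rewrite mulrC ler_pdivrMr// mulrC.
have [ak|ka] := leP a k.
  rewrite (_ : Num.max _ _ = 0); last by apply/max_idPl; lra.
  by rewrite mulr0 powR_ge0.
have a0 : 0 < a by exact: le_lt_trans ka.
rewrite powRD; last by rewrite (gt_eqF a0) implybT.
rewrite (powRr1 (ltW a0)) [leLHS]mulrC; apply: ler_pM; rewrite ?le_max ?lexx ?(ltW b0)//.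
  by rewrite ge_max (ltW a0) /=; lra.
by rewrite -kb ge0_ler_powR// ?nnegrE// ltW.
Qed.

End yosida_regularization.

(** * Passage to the limit in the regularised equation *)

Lemma cluster_subsequence (R : realType) (N : nat) (X : nat -> 'rV[R]_N) c (rho : R) :
  (forall n, enorm (X n - c) <= rho) ->
  exists p, forall n0 (e : R), 0 < e -> exists2 n, (n0 <= n)%N & enorm (X n - p) < e.
Proof.
move=> Xb; have [|p [_ pX]] := @closed_eball_compact R N c rho (X @ \oo) _.
  by exists 0%N => // n _; exact: Xb.
exists p => n0 e e0.
have [| |_ [[n n0n <-] Xn]] := pX [set X n | n in [set n | (n0 <= n)%N]] [set z | enorm (z - p) < e].
- by exists n0 => // n n0n; exists n.
- have cp : continuous (fun z : 'rV[R]_N => enorm (z - (p : 'rV[R]_N))).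
    by move=> z; apply: continuous_comp; [exact: subr_continuous|exact: enorm_continuous].
  by apply: (cvgr_lt (enorm (p - p)) (cp p)); rewrite subrr enorm0.
- by exists n.
Qed.

Section mean_operator_limit.
Context d {Xi : measurableType d} {R : realType} {N : nat} (mu : probability Xi R).
Variable A : Xi -> 'rV[R]_N -> set 'rV[R]_N.
Hypothesis A_maximal : forall xi, maximal_monotone (A xi).
Hypothesis A_measurable : set_measurable (fun xi => op_graph (A xi)).

Lemma mean_operator_limit (g : nat -> R) (X : nat -> 'rV[R]_N) (y p : 'rV[R]_N) (K : R) :
  let a n xi := yosida (A xi) (g n) (X n) in
  let q n : R := (2 ^ n.+1)%:R^-1 in
  (forall n, 0 < g n <= q n ^+ 2) ->
  (forall n, enorm (X n - p) <= q n) ->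
  (forall n, integrable_vec mu (a n)) ->
  (forall n, X n + integral_vec mu (a n) = y) ->
  (forall n, \int[mu]_xi enorm (a n xi) <= K) ->
  (forall e, 0 < e ->
    exists k, forall n, \int[mu]_xi Num.max 0 (enorm (a n xi) - k) <= e) ->
  mean_operator mu A p (y - p).
Proof.
move=> a q gq Xq ia Xy aK ui.
have q0 n : 0 < q n by rewrite invr_gt0 ltr0n expn_gt0.
have qlim : q n @[n --> \oo] --> (0 : R).
  have -> : q = [sequence (2^-1 : R) ^+ n.+1]_n.
    by apply/funext => n; rewrite /q /= exprVn natrX.
  by rewrite (cvg_shiftS (fun n => (2^-1 : R) ^+ n)); apply: cvg_expr;
    rewrite gtr0_norm ?invr_gt0// invf_lt1 ?ltr1n.
have [h [phi [hh iphi hphi Ephi]]] := uniformly_integrable_hull_limit ia ui.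
have Aphi : {ae mu, forall xi, A xi p (phi xi)}.
  have b0 n xi : 0 <= q n * enorm (a n xi) by rewrite mulr_ge0 ?enorm_ge0// ltW.
  have ib n : mu.-integrable setT (EFin \o (fun xi => q n * enorm (a n xi))).
    exact/integrable_funZ/integrable_enorm.
  (* Summable bounds, so q |a| tends to 0 almost surely. With g <= q^2, both |Y - p| <= q + q (q
     |a|) and |a| |Y - p| <= q |a| + (q |a|)^2 then vanish. *)
  have bK n : \int[mu]_xi (q n * enorm (a n xi)) <= K / (2 ^ n.+1)%:R.
    rewrite RintegralZl//; last exact: integrable_enorm.
    rewrite [leRHS]mulrC; exact: (ler_wpM2l (ltW (q0 n)) (aK n)).
  have := ae_is_cvg_series b0 ib bK; apply: filterS2 hphi => xi hxi /cvg_series_cvg_0 b_0.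
  pose Y n := op_resolvent (A xi) (g n) (X n).
  have YX n : enorm (Y n - p) <= q n + q n * (q n * enorm (a n xi)).
    have /andP[gn0 gn] := gq n.
    rewrite /Y op_resolventE// addrAC; apply: le_trans (ler_enormD _ _) _.
    apply: lerD => //; rewrite enormN enormZ gtr0_norm// mulrA -expr2.
    by apply: ler_wpM2r => //; exact: enorm_ge0.
  apply: (@midpoint_hull_limit_in Xi R N (A xi) a h xi Y p (phi xi)) => //.
  - by move=> n; apply: op_resolvent_in => //; have /andP[] := gq n.
  - apply: (@squeeze_cvgr _ _ _ _ (cst 0) (fun n => q n + q n * (q n * enorm (a n xi)))).
    + by apply: nearW => n; rewrite enorm_ge0 YX.
    + exact: cvg_cst.
    + rewrite -[X in _ --> X](addr0 0) -[X in _ --> _ + X](mulr0 0).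
      by apply: cvgD => //; exact: cvgM.
  - apply: (@squeeze_cvgr _ _ _ _ (cst 0) (fun n => (q n * enorm (a n xi))
        + (q n * enorm (a n xi)) * (q n * enorm (a n xi)))).
    + apply: nearW => n; rewrite mulr_ge0 ?enorm_ge0//=.
      have := ler_wpM2l (enorm_ge0 (a n xi)) (YX n).
      by move/le_trans; apply; rewrite le_eqVlt; apply/orP; left; apply/eqP; ring.
    + exact: cvg_cst.
    + rewrite -[X in _ --> X](addr0 0) -[X in _ --> _ + X](mulr0 0).
      by apply: cvgD => //; exact: cvgM.
split.
  apply/(mean_domain_ae mu A_measurable); apply: filterS Aphi => xi Axi.
  by exists (phi xi).
exists phi => //; apply/eqP; rewrite -subr_eq0; apply/eqP/enorm_eq0/eqP.
set w := integral_vec mu phi - (y - p).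
rewrite -sqrf_eq0 enorm_sqr {1}/w einnerDl einnerNl subr_eq0; apply/eqP.
(* The integral of [h n] is a combination of the vectors y - X k with k >= n, all in the ball of
   radius [q n] about y - p. *)
have far n : enorm (integral_vec mu (h n) - (y - p)) <= q n.
  apply: (@integral_midpoint_hull _ _ _ _ mu a ia n (h n)
    (fun z => enorm (z - (y - p)) <= q n)) (hh n) => [k nk|u v uq vq].
    rewrite -(Xy k) (_ : _ - _ = - (X k - p)); last first.
      by apply/rowP => i; rewrite !mxE; ring.
    rewrite enormN; apply: le_trans (Xq k) _.
    by rewrite lef_pV2 ?posrE ?ltr0n ?expn_gt0// ler_nat leq_exp2l.
  rewrite (_ : _ - _ = 2^-1 *: ((u - (y - p)) + (v - (y - p)))); last first.
    by apply/rowP => i; rewrite !mxE; field.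
  rewrite enormZ gtr0_norm ?invr_gt0//.
  by have := ler_enormD (u - (y - p)) (v - (y - p)); lra.
rewrite -(cvg_lim _ (Ephi w))//; apply: cvg_lim => //.
apply/cvgrPdist_le => e e0 /=.
have /cvgrPdist_le/(_ e e0) : q n * enorm w @[n --> \oo] --> (0 : R).
  by rewrite -[X in _ --> X](mul0r (enorm w)); apply: cvgMr_tmp.
apply: filterS => n; rewrite sub0r normrN ger0_norm; last first.
  by rewrite mulr_ge0 ?enorm_ge0// ltW.
apply: le_trans; rewrite -einnerNl -einnerDl ler_norml.
have := ler_wpM2r (enorm_ge0 w) (far n); rewrite enormB => fw.
rewrite (le_trans (einner_le _ _) fw) andbT (le_trans _ (einner_geN _ _))//.
by rewrite lerN2.
Qed.

End mean_operator_limit.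

Theorem proposition3p1 (R : realType) (N : nat)
    (d : measure_display) (Xi : measurableType d) (mu : probability Xi R)
    (mu_complete : measure_is_complete mu)
    (A : Xi -> 'rV[R]_N -> set 'rV[R]_N)
    (A_maximal : forall xi, maximal_monotone (A xi))
    (A_measurable : set_measurable (fun xi => op_graph (A xi)))
    (mean_domain_nonempty : mean_domain mu A !=set0)
    (A_integrable : forall x, mean_domain mu A x ->
      set_integrable mu (fun xi => A xi x))
    (interior_nonempty : (mean_domain mu A)° !=set0)
    (ball_bound : exists (c : 'rV[R]_N) (r : R) (M : Xi -> R),
      [/\ 0 < r,
          closed_eball c r `<=` mean_domain mu A,
          mu.-integrable setT (EFin \o M) &
          forall x, closed_eball c r x ->
            {ae mu, forall xi, enorm (least_norm (A xi) x) <= M xi}])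
    (moments : forall K : set 'rV[R]_N, compact K ->
      exists2 eps : R, 0 < eps &
        (ereal_sup [set \int[mu]_xi (enorm (least_norm (A xi) x) `^ (1 + eps))%:E
                   | x in K `&` mean_domain mu A] < +oo)%E /\
        exists2 y0, mean_domain mu A y0 &
          (\int[mu]_xi (enorm (least_norm (A xi) y0) `^ (1 + eps^-1))%:E
             < +oo)%E)
    (linear_regularity : exists2 C : R, 0 < C & forall x : 'rV[R]_N,
      ((C * dist_set (mean_domain mu A) x)%:E
         <= \int[mu]_xi (dist_set (op_dom (A xi)) x)%:E)%E)
    (resolvent_bound : exists2 C : 'rV[R]_N -> R,
      (forall K : set 'rV[R]_N, compact K -> [bounded C x | x in K]) &
      forall (x : 'rV[R]_N) (gamma : R), 0 < gamma ->
        (\int[mu]_xi (enorm (op_resolvent (A xi) gamma x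
                             - nearest_point (closure (op_dom (A xi))) x))%:E
           <= (gamma * C x)%:E)%E) :
  maximal_monotone (mean_operator mu A).
Proof.
have [c [r [M [r0 ball_dom iM bnd]]]] := ball_bound.
have [C C0 Creg] := linear_regularity.
apply: maximal_monotone_of_surjective; first exact: mean_operator_monotone.
move=> y; suff [p Ap] : exists p, mean_operator mu A p (y - p).
  by exists p, (y - p); split=> //; rewrite addrC subrK.
pose g n : R := n.+1%:R^-1.
have g0 n : 0 < g n by rewrite invr_gt0 ltr0n.
have g1 n : g n <= 1 by rewrite invf_le1 ?ltr0n// ler1n.
have iy n x := integrable_yosida A_maximal A_measurable r0 ball_dom iM bnd x (g0 n).
have /choice[X Xy] : forall n, exists x, x + mean_yosida mu A (g n) x = y.
  by move=> n; exact: (mean_yosida_solution A_maximal A_measurable r0 ball_dom iM bnd).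
have Xb n := solution_bounded A_maximal A_measurable r0 ball_dom iM bnd (g0 n) (Xy n).
have [K0 XK0] := solution_yosida_bounded A_maximal A_measurable r0 ball_dom iM bnd y.
pose K := Num.max 0 K0.
have XK n : \int[mu]_xi enorm (yosida (A xi) (g n) (X n)) <= K.
  by rewrite le_max (XK0 _ _ (g0 n) (Xy n)) orbT.
pose L := K / C + 1.
have L0 : 0 <= L by rewrite addr_ge0// divr_ge0 ?le_max ?lexx// ltW.
have Xz n : exists2 z, mean_domain mu A z & enorm (X n - z) <= g n * L.
  exact: (near_mean_domain A_maximal A_measurable r0 ball_dom iM bnd C0 (g0 n) (Creg _) (XK n)).
move: Xb; set rho := _ + _ => Xb.
(* Since g n <= 1, this fixed ball contains every point [z] given by [Xz], so a single exponent
   serves all n. *)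
pose S := closed_eball c (rho + L).
have [eps eps0 [supS _]] := moments S (@closed_eball_compact R N c (rho + L)).
set s := ereal_sup _ in supS.
have SB z : S z -> mean_domain mu A z ->
    (\int[mu]_xi (enorm (least_norm (A xi) z) `^ (1 + eps))%:E <= (fine s)%:E)%E.
  move=> Sz Dz.
  have les : (\int[mu]_xi (enorm (least_norm (A xi) z) `^ (1 + eps))%:E <= s)%E.
    by apply: ereal_sup_ubound; exists z.
  rewrite fineK// ge0_fin_numE//; apply: le_trans les.
  by apply: integral_ge0 => xi _; rewrite lee_fin powR_ge0.
have ui e : 0 < e -> exists k, forall n,
    \int[mu]_xi Num.max 0 (enorm (yosida (A xi) (g n) (X n)) - k) <= e.
  move=> e0; have [k kP] := yosida_uniformly_integrable A_maximal A_measurable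
    r0 ball_dom iM bnd L0 eps0 SB e0.
  exists k => n; have [z Dz Xz_] := Xz n; apply: (kP _ _ z) => //.
  rewrite /S /closed_eball /= -(subrK (X n) z) -addrA.
  apply: le_trans (ler_enormD _ _) _; rewrite [leRHS]addrC; apply: lerD => //; rewrite enormB.
  by apply: le_trans Xz_ _; rewrite ler_piMl.
have [p pX] := cluster_subsequence Xb.
pose q n : R := (2 ^ n.+1)%:R^-1.
have q0 n : 0 < q n by rewrite invr_gt0 ltr0n expn_gt0.
have /choice[t tP] : forall n, exists k, g k <= q n ^+ 2 /\ enorm (X k - p) <= q n.
  (* An index beyond 4^(n+1) makes g k <= q n ^ 2. The indices [t n] are chosen independently and
     may fail to increase. *)
  move=> n; have [k nk Xp] := pX (2 ^ n.+1 * 2 ^ n.+1)%N (q n) (q0 n).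
  exists k; split; last exact: ltW.
  rewrite /g /q expr2 -invfM -natrM lef_pV2 ?posrE ?ltr0n ?muln_gt0 ?expn_gt0//.
  by rewrite ler_nat leqW.
exists p; apply: (@mean_operator_limit _ _ _ _ mu A A_maximal A_measurable
  (g \o t) (X \o t) y p K) => [n|n|n|n|n|e e0] /=.
- by rewrite g0; have [] := tP n.
- by have [] := tP n.
- exact: iy.
- exact: Xy.
- exact: XK.
- by have [k kP] := ui e e0; exists k => n; exact: kP.
Qed.
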